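(* Let $X$ be a real Banach space. If $\operatorname{span}(\mathrm{NA}(X))$ is a weak-star modest subspace of $X^*$, then the Read norm $p(x)=\|x\|_X+\|R(x)\|_{\ell_1}$ $(x\in X)$ given by the construction described in the context is strictly convex. Moreover, if $\operatorname{span}(\mathrm{NA}(X))$ is actually a modest subspace of $X^*$, then $p$ can be built (within this construction) in such a way that $(X,p)^{**}$ is strictly convex and so $(X,p)^*$ is smooth.
   Context: All Banach spaces are real. $\mathrm{NA}(X)$ is the set of all $f\in X^*$ with $\|f\|=|f(x)|$ for some $x\in S_X$ (unit sphere); $\mathrm{NA}(X,p)$ is the same set when $X$ is endowed with the equivalent norm $p$. An equivalent norm $p$ on $X$ is a Read norm if $\mathrm{NA}(X,p)$ does not contain any two-dimensional linear subspace. A Banach space is strictly convex if its unit sphere contains no non-trivial segment; it is smooth if its norm is Gâteaux differentiable at every non-zero element. A linear subspace $Y$ of a Banach space $V$ is an operator range if there are an infinite-dimensional Banach space $E$ and a bounded injective linear operator $T\colon E\to V$ with $T(E)=Y$. A linear subspace $Z\subset V$ is modest if there is a separable (norm) dense operator range $Y\subset V$ with $Z\cap Y=\{0\}$. If $V$ is a dual space, $Z\subset V$ is weak-star modest if there is a (norm-)separable weak-star dense operator range $Y\subset V$ with $Z\cap Y=\{0\}$. Construction of $p$ when $\operatorname{span}(\mathrm{NA}(X))$ is weak-star modest: take a separable weak-star dense operator range $Y\subset X^*$ with $Y\cap\operatorname{span}(\mathrm{NA}(X))=\{0\}$ which is of the form $Y=T(\ell_1)$ for an injective norm-one linear operator $T\colon\ell_1\to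 X^*$ such that $\{Te_n/\|Te_n\| : n\in\mathbb N\}$ is norm dense in $S_Y=\{y\in Y:\|y\|=1\}$, where $(e_n)$ is the canonical basis of $\ell_1$ (such $Y$ and $T$ exist; if $\operatorname{span}(\mathrm{NA}(X))$ is modest, $Y$ can be chosen norm dense in $X^*$, so that $\{Te_n/\|Te_n\|\}$ is norm dense in $S_{X^*}$). Put $v_n^*=Te_n$, take positive reals $r_n$ with $\sum_n r_n<\infty$, define $R\colon X\to\ell_1$ by $[R(x)](n)=r_n v_n^*(x)$, and set $p(x)=\|x\|_X+\|R(x)\|_{\ell_1}$. This $p$ is an equivalent Read norm on $X$. *)

(* Defs.v *)
From HB Require Import structures.
From mathcomp Require Import all_boot all_order all_algebra.
From mathcomp Require Import all_classical all_reals all_analysis.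

Set Implicit Arguments.
Unset Strict Implicit.
Unset Printing Implicit Defensive.

Import Order.TTheory GRing.Theory Num.Theory.
Import numFieldNormedType.Exports.

Local Open Scope classical_set_scope.
Local Open Scope ring_scope.

(* [sup] of an unbounded set is 0, so [opnorm f] is the operator norm only for
   bounded [f]; it is used for continuous linear maps only. *)
Definition opnorm (R : realType) (V W : normedModType R) (f : V -> W) : R :=
  sup [set `|f x| | x in [set x : V | `|x| <= 1]].

Section OpNorm.
Variables (R : realType) (V W : normedModType R).

Lemma opnorm_nonempty (f : V -> W) :
  [set `|f x| | x in [set x : V | `|x| <= 1]] !=set0.
Proof. by exists `|f 0|, 0 => //=; rewrite normr0. Qed.

Lemma opnorm_ubound (f : {linear V -> W}) : continuous f ->
  has_ubound [set `|f x| | x in [set x : V | `|x| <= 1]].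
Proof.
move=> /linear_bounded_continuous/bounded_funP/(_ 1)[M fM].
by exists M => _ [x /= x1 <-]; exact: fM.
Qed.

Lemma opnorm_ge0 (f : V -> W) : 0 <= opnorm f.
Proof.
rewrite /opnorm; set A := (X in sup X).
have [ubA|ubA] := pselect (has_ubound A); last first.
  by rewrite sup_out// => -[].
apply: (le_trans (normr_ge0 (f 0))); apply: ub_le_sup => //.
by exists 0 => //=; rewrite normr0.
Qed.

Lemma opnorm_bound (f : {linear V -> W}) x : continuous f ->
  `|f x| <= opnorm f * `|x|.
Proof.
move=> cf; have [->|x0] := eqVneq x 0; first by rewrite linear0 !normr0 mulr0.
have nx : 0 < `|x| by rewrite normr_gt0.
rewrite -ler_pdivrMr// mulrC.
have -> : `|x|^-1 * `|f x| = `|f (`|x|^-1 *: x)|.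
  by rewrite linearZ/= normrZ gtr0_norm// invr_gt0.
apply: ub_le_sup; first exact: opnorm_ubound.
by exists (`|x|^-1 *: x) => //=; rewrite normrZ gtr0_norm ?invr_gt0// mulVf ?gt_eqF.
Qed.

Lemma opnorm_le (f : V -> W) (M : R) :
  (forall x, `|x| <= 1 -> `|f x| <= M) -> opnorm f <= M.
Proof.
move=> fM; apply: ge_sup; first exact: opnorm_nonempty.
by move=> _ [x /= x1 <-]; exact: fM.
Qed.

End OpNorm.

Section Dual.
Variables (R : realType) (V : normedModType R).

Definition dual_pred : {pred V -> R^o} :=
  mem [set f : V -> R^o | linear f /\ continuous f].

Record dual := Dual { dual_fun :> V -> R^o; _ : dual_fun \in dual_pred }.

HB.instance Definition _ := [isSub for dual_fun].
HB.instance Definition _ := [Choice of dual by <:].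

Lemma dual_pred_submod_closed : submod_closed dual_pred.
Proof.
split.
  rewrite inE; split; last exact: cst_continuous.
  by move=> a x y /=; rewrite scaler0 addr0.
move=> a f g /[!inE] -[lf cf] [lg cg]; split.
  move=> b x y; rewrite !fctE /=.
  rewrite lf lg !scalerDr !scalerA (mulrC a b) -!addrA; congr (_ + _).
  by rewrite addrCA.
move=> x; apply: cvgD; last exact: cg.
by apply: cvgZr; exact: cf.
Qed.

HB.instance Definition _ :=
  GRing.isSubmodClosed.Build R (V -> R^o) dual_pred dual_pred_submod_closed.
HB.instance Definition _ := [SubChoice_isSubLmodule of dual by <:].

Lemma dual_linear (f : dual) : linear (dual_fun f).
Proof. by case: f => f /= /[!inE] -[]. Qed.

HB.instance Definition _ (f : dual) :=
  GRing.isLinear.Build R V R^o _ (dual_fun f) (dual_linear f).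

Lemma dual_continuous (f : dual) : continuous (f : V -> R^o).
Proof. by case: f => f /= /[!inE] -[]. Qed.

Definition dual_norm (f : dual) : R := opnorm (f : V -> R^o).

Lemma dual_norm_bound (f : dual) x : `|f x| <= dual_norm f * `|x|.
Proof. exact: (opnorm_bound (f := dual_fun f) x (@dual_continuous f)). Qed.

Lemma dual_normD (f g : dual) : dual_norm (f + g) <= dual_norm f + dual_norm g.
Proof.
apply: opnorm_le => x x1 /=; apply: (le_trans (ler_normD _ _)).
apply: lerD; apply: (le_trans (dual_norm_bound _ _));
  by rewrite ler_piMr ?opnorm_ge0.
Qed.

Lemma dual_normZ_le (a : R) (f : dual) : dual_norm (a *: f) <= `|a| * dual_norm f.
Proof.
apply: opnorm_le => x x1 /=.
have -> : `|dual_fun (a *: f) x| = `|a| * `|f x| by exact: (normrZ a (f x : R^o)).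
rewrite ler_wpM2l//.
by apply: (le_trans (dual_norm_bound _ _)); rewrite ler_piMr ?opnorm_ge0.
Qed.

Lemma dual_normZ (a : R) (f : dual) : dual_norm (a *: f) = `|a| * dual_norm f.
Proof.
apply/eqP; rewrite eq_le dual_normZ_le /=.
have [->|a0] := eqVneq a 0; first by rewrite normr0 mul0r opnorm_ge0.
rewrite -ler_pdivlMl ?normr_gt0// -normfV.
by apply: le_trans (dual_normZ_le _ _); rewrite scalerA mulVf// scale1r.
Qed.

Lemma dual_norm_eq0 (f : dual) : dual_norm f = 0 -> f = 0.
Proof.
move=> f0; apply/val_inj/funext => x /=; apply/eqP.
by rewrite -normr_le0 (le_trans (dual_norm_bound f x))// f0 mul0r.
Qed.

HB.instance Definition _ :=
  Lmodule_isNormed.Build R dual dual_normD dual_normZ dual_norm_eq0.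

Lemma dual_normE (f : dual) : `|f| = opnorm (f : V -> R^o). Proof. by []. Qed.

End Dual.

Definition weak_star (R : realType) (X : normedModType R) :=
  initial_topology (fun f : dual X => (f : {ptws X -> R^o})).

Section Ell1.
Variable R : realType.

Definition ell1_pred : {pred nat -> R^o} :=
  mem [set u : nat -> R^o | cvgn [normed series u]].

Record ell1 := Ell1 { ell1_fun :> nat -> R^o; _ : ell1_fun \in ell1_pred }.

HB.instance Definition _ := [isSub for ell1_fun].
HB.instance Definition _ := [Choice of ell1 by <:].

Lemma normed_series_bounded_cvg (u : nat -> R^o) (M : R) :
  (forall n, [normed series u] n <= M) -> cvgn [normed series u].
Proof.
move=> uM; apply: nondecreasing_is_cvgn.
  by apply: nondecreasing_series => *; exact: normr_ge0.
by exists M => _ [n _ <-].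
Qed.

Lemma normed_series_le_lim (u : nat -> R^o) n : cvgn [normed series u] ->
  [normed series u] n <= limn [normed series u].
Proof.
move=> cu; apply: nondecreasing_cvgn_le => //.
by apply: nondecreasing_series => *; exact: normr_ge0.
Qed.

Lemma normed_series_lim_le (u : nat -> R^o) (M : R) :
  (forall n, [normed series u] n <= M) -> limn [normed series u] <= M.
Proof.
by move=> uM; apply: limr_le;
  [exact: normed_series_bounded_cvg uM|exact: nearW].
Qed.

Lemma normed_seriesD_le (u v : nat -> R^o) n :
  [normed series (u + v)] n <= [normed series u] n + [normed series v] n.
Proof.
by rewrite /series/= -big_split/=; apply: ler_sum => i _; exact: ler_normD.
Qed.

Lemma normed_seriesZ (a : R) (u : nat -> R^o) n :
  [normed series (a *: u)] n = `|a| * [normed series u] n.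
Proof. by rewrite /series/= mulr_sumr; apply: eq_bigr => i _; exact: normrZ. Qed.

Lemma ell1_pred_submod_closed : submod_closed ell1_pred.
Proof.
split.
  rewrite inE; apply: (@normed_series_bounded_cvg _ 0) => n /=.
  by rewrite /series/= big1// => i _; rewrite normr0.
move=> a u v /[!inE] cu cv.
apply: (@normed_series_bounded_cvg _
  (`|a| * limn [normed series u] + limn [normed series v])) => n.
apply: (le_trans (normed_seriesD_le _ _ _)); rewrite normed_seriesZ.
by apply: lerD; [rewrite ler_wpM2l//|]; exact: normed_series_le_lim.
Qed.

HB.instance Definition _ :=
  GRing.isSubmodClosed.Build R (nat -> R^o) ell1_pred ell1_pred_submod_closed.
HB.instance Definition _ := [SubChoice_isSubLmodule of ell1 by <:].

Definition ell1_norm (u : ell1) : R := limn [normed series (u : nat -> R^o)].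

Lemma ell1_cvg (u : ell1) : cvgn [normed series (u : nat -> R^o)].
Proof. by case: u => u /= /[!inE]. Qed.

Lemma ell1_norm_ge (u : ell1) n :
  \sum_(0 <= k < n) `|u k| <= ell1_norm u.
Proof. exact: (@normed_series_le_lim (u : nat -> R^o) n (@ell1_cvg u)). Qed.

Lemma ell1_norm_le (u : ell1) (M : R) :
  (forall n, \sum_(0 <= k < n) `|u k| <= M) -> ell1_norm u <= M.
Proof. exact: (@normed_series_lim_le (u : nat -> R^o)). Qed.

Lemma ell1_normD (u v : ell1) : ell1_norm (u + v) <= ell1_norm u + ell1_norm v.
Proof.
apply: ell1_norm_le => n; apply: (le_trans (normed_seriesD_le _ _ _)).
by apply: lerD; exact: ell1_norm_ge.
Qed.

Lemma ell1_normZ (a : R) (u : ell1) : ell1_norm (a *: u) = `|a| * ell1_norm u.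
Proof.
rewrite /ell1_norm; have -> : [normed series (a *: u : ell1) : nat -> R^o] =
    (fun n => `|a| * [normed series (u : nat -> R^o)] n).
  by apply/funext => n; exact: normed_seriesZ.
by apply/cvg_lim => //; apply: cvgMr; exact: ell1_cvg.
Qed.

Lemma ell1_norm_coord (u : ell1) k : `|u k| <= ell1_norm u.
Proof.
apply: le_trans (ell1_norm_ge u k.+1); rewrite big_nat_recr//= lerDr.
by apply: sumr_ge0 => *; exact: normr_ge0.
Qed.

Lemma ell1_norm_eq0 (u : ell1) : ell1_norm u = 0 -> u = 0.
Proof.
move=> u0; apply/val_inj/funext => k /=; apply/eqP.
by rewrite -normr_le0 -u0; exact: ell1_norm_coord.
Qed.

HB.instance Definition _ :=
  Lmodule_isNormed.Build R ell1 ell1_normD ell1_normZ ell1_norm_eq0.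

Lemma ell1_complete (F : set_system ell1) :
  ProperFilter F -> cauchy F -> cvg F.
Proof.
move=> FF Fc; have cballF : cauchy_ex F by apply/cauchyP.
have cvg_coord k : cvg ((fun g : ell1 => g k : R^o) @ F).
  apply: R_complete; apply/cauchyP => e e0.
  have [f Ff] := cballF _ e0; exists (f k).
  apply: (@filterS _ F _ _ _ _ Ff) => g; rewrite -!ball_normE /= => fg.
  exact: le_lt_trans (ell1_norm_coord (f - g) k) fg.
pose u : nat -> R^o := fun k => lim ((fun g : ell1 => g k : R^o) @ F).
have u_close (f : ell1) e : F (ball f e) ->
    forall n, \sum_(0 <= k < n) `|f k - u k| <= e.
  move=> Ff n.
  have cvg_sum : (fun g : ell1 => \sum_(0 <= k < n) `|f k - g k| : R^o) @ F -->
      (\sum_(0 <= k < n) `|f k - u k| : R^o).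
    apply: cvg_big => [|k _]; first exact: add_continuous.
    apply: cvg_norm; apply: cvgB; first exact: cvg_cst.
    exact: cvg_coord.
  rewrite -(cvg_lim _ cvg_sum)//; apply: limr_le; first exact: cvgP cvg_sum.
  apply: filterS Ff => g; rewrite -ball_normE /= => /ltW.
  by apply: le_trans; exact: (ell1_norm_ge (f - g) n).
have uP : u \in ell1_pred.
  have [f Ff] := cballF 1 ltr01.
  rewrite inE; apply: (@normed_series_bounded_cvg _ (ell1_norm f + 1)) => n.
  rewrite /series/=.
  apply: (@le_trans _ _ (\sum_(0 <= k < n) (`|f k| + `|f k - u k|))).
    apply: ler_sum => k _; rewrite -[X in `|X|](subrK (f k)) addrC distrC.
    exact: ler_normD.
  by rewrite big_split/= lerD ?ell1_norm_ge//; exact: u_close.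
apply/cvg_ex; exists (Ell1 uP); apply/cvgrPdist_le => e e0.
have [f Ff] := cballF _ (divr_gt0 e0 (ltr0n R 2)).
apply: filterS (Ff) => g; rewrite -ball_normE /= => fg.
rewrite (splitr e) -(subrKA f) (le_trans (ler_normD _ _))// lerD//; last exact: ltW.
rewrite distrC; apply: ell1_norm_le => n; exact: u_close Ff n.
Qed.

HB.instance Definition _ := Uniform_isComplete.Build ell1 ell1_complete.

Lemma ell1_delta_sum (n m : nat) :
  \sum_(0 <= k < m) `|(k == n)%:R : R^o| = (n < m)%N%:R.
Proof.
elim: m => [|m IH]; first by rewrite big_geq.
rewrite big_nat_recr//= IH normr_nat ltnS [in RHS]leq_eqVlt eq_sym.
by case: ltngtP => //=; rewrite ?addr0 ?add0r.
Qed.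

Lemma ell1_delta_subproof (n : nat) :
  (fun k => (k == n)%:R : R^o) \in ell1_pred.
Proof.
rewrite inE; apply: (@normed_series_bounded_cvg _ 1) => m.
by rewrite /series/= [leLHS](ell1_delta_sum n m) lern1; case: (n < m)%N.
Qed.

Definition ell1_delta (n : nat) : ell1 := Ell1 (ell1_delta_subproof n).

Lemma ell1_norm_delta n : `|ell1_delta n| = 1.
Proof.
apply/eqP; rewrite eq_le; apply/andP; split.
  apply: ell1_norm_le => m.
  by rewrite [leLHS](ell1_delta_sum n m) lern1; case: (n < m)%N.
apply: le_trans (ell1_norm_ge _ n.+1).
by rewrite [leRHS](ell1_delta_sum n n.+1) ltnSn.
Qed.

End Ell1.

Section Modest.
Variable R : realType.

Definition lin_span (V : lmodType R) (A : set V) : set V :=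
  [set x | exists n (c : 'I_n -> R) (v : 'I_n -> V),
     (forall i, A (v i)) /\ x = \sum_(i < n) c i *: v i].

Definition infinite_dim (V : lmodType R) : Prop :=
  ~ exists n (v : 'I_n -> V), lin_span (range v) = setT.

Definition operator_range (V : normedModType R) (Y : set V) : Prop :=
  exists (E : completeNormedModType R) (T : {linear E -> V}),
    [/\ infinite_dim E, bounded_fun_norm T, injective T & range T = Y].

Definition separable_set (V : topologicalType) (Y : set V) : Prop :=
  exists D : set V, [/\ countable D, D `<=` Y & Y `<=` closure D].

Definition modest (V : normedModType R) (Z : set V) : Prop :=
  exists Y : set V, [/\ operator_range Y, separable_set Y, dense Y &
    Z `&` Y = [set 0]].

Definition weak_star_modest (X : normedModType R) (Z : set (dual X)) : Prop :=
  exists Y : set (dual X), [/\ operator_range Y, separable_set Y,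
    dense (Y : set (weak_star X)) & Z `&` Y = [set 0]].

Definition norm_attaining (X : normedModType R) : set (dual X) :=
  [set f : dual X | exists2 x : X, `|x| = 1 & `|f| = `|f x|].

Definition strictly_convex (V : normedModType R) : Prop :=
  forall x y : V,
    (forall t : R, 0 <= t <= 1 -> `|(1 - t) *: x + t *: y| = 1) -> x = y.

(* [is_derive x h f l] is convergence of [t^-1 *: (f (t *: h + x) - f x)] to
   [l] as t -> 0, t != 0; Gateaux differentiability asks that the directional
   derivatives form a bounded linear functional of the direction [h]. *)
Definition smooth (V : normedModType R) : Prop :=
  forall x : V, x != 0 ->
    exists L : dual V, forall h : V, is_derive x h (fun z : V => `|z| : R^o) (L h).

End Modest.
Arguments norm_attaining {R} X.

Record equiv_norm (R : realType) (X : normedModType R) := EquivNorm {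
  equiv_norm_fun :> X -> R;
  equiv_normD : forall x y,
    equiv_norm_fun (x + y) <= equiv_norm_fun x + equiv_norm_fun y;
  equiv_normZ : forall (a : R) x,
    equiv_norm_fun (a *: x) = `|a| * equiv_norm_fun x;
  equiv_norm_bounds : exists c C : R, [/\ 0 < c, 0 < C &
    forall x, c * `|x| <= equiv_norm_fun x <= C * `|x|] }.

(* The normed space (X, p). *)
Definition renorm (R : realType) (X : normedModType R) (p : equiv_norm X) : Type :=
  X.

Section Renorm.
Variables (R : realType) (X : normedModType R) (p : equiv_norm X).

HB.instance Definition _ := GRing.Lmodule.on (renorm p).

Lemma equiv_norm_eq0 (x : renorm p) : p x = 0 -> x = 0.
Proof.
have [c [C [c0 _ /(_ x)/andP[+ _]]]] := equiv_norm_bounds p => /[swap] ->.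
rewrite pmulr_rle0// normr_le0 => /eqP; exact.
Qed.

HB.instance Definition _ := Lmodule_isNormed.Build R (renorm p)
  (@equiv_normD R X p) (@equiv_normZ R X p) equiv_norm_eq0.

Lemma renormE (x : renorm p) : `|x| = p x. Proof. by []. Qed.

End Renorm.

(* The choices made in building the norm p: the separable weak-star dense
   operator range Y is [range rc_T], and v_n^* is [rc_T (ell1_delta R n)]. *)
Record read_construction (R : realType) (X : normedModType R) := ReadConstruction {
  rc_T : {linear ell1 R -> dual X};
  rc_bounded : bounded_fun_norm rc_T;
  rc_norm1 : opnorm rc_T = 1;
  rc_inj : injective rc_T;
  rc_operator_range : operator_range (range rc_T);
  rc_separable : separable_set (range rc_T);
  rc_dense : dense (range rc_T : set (weak_star X));
  rc_disjoint : range rc_T `&` lin_span (norm_attaining X) = [set 0];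
  rc_sphere_dense :
    [set y | range rc_T y /\ `|y| = 1] `<=`
    closure (range (fun n =>
      `|rc_T (ell1_delta R n)|^-1 *: rc_T (ell1_delta R n)));
  rc_r : nat -> R;
  rc_r_gt0 : forall n, 0 < rc_r n;
  rc_r_summable : cvgn (series rc_r) }.

Section ReadNorm.
Variables (R : realType) (X : normedModType R) (D : read_construction X).

Definition rc_v (n : nat) : dual X := rc_T D (ell1_delta R n).

Lemma rc_v_norm n : `|rc_v n| <= 1.
Proof.
have cT : continuous (rc_T D).
  exact/bounded_linear_continuous/bounded_funP/(rc_bounded D).
have := opnorm_bound (ell1_delta R n) cT.
by rewrite rc_norm1 ell1_norm_delta mulr1.
Qed.

Lemma rc_R_sum x n :
  \sum_(0 <= k < n) `|rc_r D k * rc_v k x| <= limn (series (rc_r D)) * `|x|.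
Proof.
apply: (@le_trans _ _ (\sum_(0 <= k < n) rc_r D k * `|x|)).
  apply: ler_sum => k _; rewrite normrM gtr0_norm ?rc_r_gt0// ler_pM2l ?rc_r_gt0//.
  apply: (le_trans (dual_norm_bound _ _)); rewrite ler_piMl//; exact: rc_v_norm.
rewrite -mulr_suml ler_wpM2r//.
apply: (@nondecreasing_cvgn_le _ (series (rc_r D))); last exact: rc_r_summable.
by apply: nondecreasing_series => k _ _; exact/ltW/rc_r_gt0.
Qed.

Lemma rc_R_subproof x : (fun n => rc_r D n * rc_v n x : R^o) \in @ell1_pred R.
Proof.
rewrite inE; apply: normed_series_bounded_cvg => n; exact: rc_R_sum.
Qed.

Definition rc_R (x : X) : ell1 R := Ell1 (rc_R_subproof x).

Definition read_norm_fun (x : X) : R := `|x| + `|rc_R x|.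

Lemma read_normD x y :
  read_norm_fun (x + y) <= read_norm_fun x + read_norm_fun y.
Proof.
have -> : read_norm_fun (x + y) = `|x + y| + `|rc_R x + rc_R y|.
  congr (_ + `|_|); apply/val_inj/funext => n /=.
  by rewrite linearD mulrDr.
by rewrite /read_norm_fun addrACA lerD// ler_normD.
Qed.

Lemma read_normZ a x : read_norm_fun (a *: x) = `|a| * read_norm_fun x.
Proof.
have -> : read_norm_fun (a *: x) = `|a *: x| + `|a *: rc_R x|.
  congr (_ + `|_|); apply/val_inj/funext => n /=.
  by rewrite linearZ/= mulrCA.
by rewrite /read_norm_fun !normrZ mulrDr.
Qed.

Lemma read_norm_bounds : exists c C : R, [/\ 0 < c, 0 < C &
  forall x, c * `|x| <= read_norm_fun x <= C * `|x|].
Proof.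
have s0 : 0 <= limn (series (rc_r D)).
  apply: limr_ge; first exact: rc_r_summable.
  by apply: nearW => n; apply: sumr_ge0 => k _; exact/ltW/rc_r_gt0.
exists 1, (1 + limn (series (rc_r D))); split=> //; first exact: ltr_wpDr.
move=> x; rewrite mul1r lerDl normr_ge0/= mulrDl mul1r lerD2l.
by apply: ell1_norm_le => n; exact: rc_R_sum.
Qed.

Definition read_norm : equiv_norm X :=
  EquivNorm read_normD read_normZ read_norm_bounds.

End ReadNorm.

(* Main.v *)
(* If p (x + y) = p x + p y then equality holds in every coordinate of R, so
   v_n x and v_n y never have opposite signs. As the directions of the v_n are
   dense in the sphere of a weak-star dense subspace, f x and f y never have
   opposite signs for f in X^*, and then y is a nonnegative multiple of x. The
   bidual norm is again of the form Phi |-> |Phi| + sum_n r_n |Phi v_n|, where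
   the first norm is that of X^**, so the same argument applies to it once the
   range of T is norm dense.

   To produce T inside a given dense operator range, take vectors w_n of that
   range, linearly independent and with dense directions, and multiply them by
   constants decaying so fast that a |-> sum_n a_n w_n is injective on l_1: at an
   index where |a_n| is maximal the later terms are too small to cancel a_n w_n
   modulo the earlier ones. *)

From HB Require Import structures.
Require Import Defs.
From mathcomp Require Import all_boot all_order all_algebra.
From mathcomp Require Import all_classical all_reals all_analysis.
From mathcomp Require Import ring lra.

Set Implicit Arguments.
Unset Strict Implicit.
Unset Printing Implicit Defensive.

Import Order.TTheory GRing.Theory Num.Theory.
Import numFieldNormedType.Exports.

Local Open Scope classical_set_scope.
Local Open Scope ring_scope.

(** * The Hahn-Banach theorem *)

Section HahnBanach.
Variables (R : realType) (V : lmodType R).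
Implicit Types (p q : V -> R).

Definition sublinear p : Prop :=
  (forall x y, p (x + y) <= p x + p y) /\
  (forall s x, 0 < s -> p (s *: x) = s * p x).

Lemma sublinear0 p : sublinear p -> p 0 = 0.
Proof. by move=> [_ pZ]; have := pZ 2 0 (ltr0Sn _ 1); rewrite scaler0 => ?; lra. Qed.

Lemma sublinearN p x : sublinear p -> - p (- x) <= p x.
Proof.
by move=> sp; have := sp.1 x (- x); rewrite subrr (sublinear0 sp) => ?; lra.
Qed.

(** The index may change under sums and positive scaling, so that one lemma serves chains of
    functionals, tilting along a ray, and difference quotients of the norm. The minorant [m] keeps
    every infimum finite. *)
Lemma sublinear_inf (I : Type) (A : set I) (F : I -> V -> R) (m : V -> R) :
    A !=set0 ->
    (forall i x, A i -> m x <= F i x) ->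
    (forall i j x y, A i -> A j ->
      exists2 k, A k & F k (x + y) <= F i x + F j y) ->
    (forall i s x, A i -> 0 < s -> exists2 k, A k & F k (s *: x) <= s * F i x) ->
  sublinear (fun x => inf [set F i x | i in A]) /\
  (forall i x, A i -> inf [set F i x | i in A] <= F i x).
Proof.
move=> [i0 Ai0] mF FD FZ; set p := fun x => inf _.
have infp x : has_inf [set F i x | i in A].
  split; first by exists (F i0 x), i0.
  by exists (m x) => _ [i Ai <-]; exact: mF.
have pF i x : A i -> p x <= F i x.
  by move=> Ai; apply: ge_inf; [exact: (infp x).2|exists i].
have pZ s x : 0 < s -> p (s *: x) <= s * p x.
  move=> s0; rewrite -ler_pdivrMl//; apply: lb_le_inf; first exact: (infp x).1.
  move=> _ [i Ai <-]; rewrite ler_pdivrMl//.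
  by have [k Ak] := FZ i s x Ai s0; apply: le_trans; exact: pF.
split=> //; split=> [x y|s x s0].
  apply/ler_addgt0Pl => e e0; have e2 : 0 < e / 2 by rewrite divr_gt0.
  have [_ [i Ai <-] Fx] := inf_adherent e2 (infp x).
  have [_ [j Aj <-] Fy] := inf_adherent e2 (infp y).
  have [k Ak Fk] := FD i j x y Ai Aj.
  have := pF k (x + y) Ak; move: Fx Fy Fk; rewrite -/(p x) -/(p y) => *; lra.
apply/eqP; rewrite eq_le pZ//= -ler_pdivlMl//.
rewrite -{1}[x](@scalerK _ _ s) ?gt_eqF//.
by apply: pZ; rewrite invr_gt0.
Qed.

(** Zorn's lemma, with the pointwise infimum as lower bound of a chain. *)
Lemma minimal_sublinear q : sublinear q ->
  exists p, [/\ sublinear p, forall x, p x <= q x &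
    forall p', sublinear p' -> (forall x, p' x <= p x) -> p' = p].
Proof.
move=> sq; pose P p := sublinear p /\ forall x, p x <= q x.
pose T := {p : V -> R | P p}.
(* The order is reversed, so that a maximal element is a minimal functional. *)
pose r := fun s t : T => `[< forall x, sval t x <= sval s x >].
have Pq : P q by [].
have [||A totA|[p [sp pq]] pmin] := @ZL_preorder T (exist _ q Pq) r.
- by move=> t; apply/asboolP.
- move=> a b c /asboolP ab /asboolP bc; apply/asboolP => x.
  exact: le_trans (bc x) (ab x).
- have [[t0 At0]|A0] := pselect (A !=set0); last first.
    by exists (exist _ q Pq) => s As; exfalso; apply: A0; exists s.
  (* Every sublinear functional below [q] stays above [- q (- x)], so the infimum over a chain is
     finite. *)
  have lbA (i : T) x : A i -> - q (- x) <= sval i x.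
    move=> _; apply: le_trans (sublinearN x (proj2_sig i).1).
    by rewrite lerN2; exact: (proj2_sig i).2.
  have [|||sp pA] := @sublinear_inf T A (fun t => sval t) _ _ lbA.
  + by exists t0.
  + move=> i j x y Ai Aj; have [/asboolP ij|/asboolP ji] := totA _ _ Ai Aj.
      exists j => //; apply: (le_trans ((proj2_sig j).1.1 x y)).
      by rewrite lerD2r.
    exists i => //; apply: (le_trans ((proj2_sig i).1.1 x y)).
    by rewrite lerD2l.
  + by move=> i s x Ai s0; exists i => //; rewrite (proj2_sig i).1.2.
  have Pp : P (fun x => inf [set sval i x | i in A]).
    split=> // x; apply: (le_trans (pA t0 x At0)); exact: (proj2_sig t0).2.
  by exists (exist _ _ Pp) => s As; apply/asboolP => x /=; exact: pA.
exists p; split=> // p' sp' p'p; apply/funext => x; apply/eqP; rewrite eq_le p'p/=.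
have Pp' : P p' by split=> // y; exact: le_trans (p'p y) (pq y).
have /asboolP := pmin (exist _ p' Pp') (introT (asboolP _) p'p).
exact.
Qed.

(** Take the infimum of [p (x + t y) - t p y] over [t >= 0]: the value [t = 0] gives [p' <= p], and
    [t = 1] at [x = - y] gives the last inequality. *)
Lemma sublinear_tilt p y : sublinear p -> exists p', [/\ sublinear p',
  forall x, p' x <= p x & p' (- y) <= - p y].
Proof.
move=> sp; pose F (t : R) x := p (x + t *: y) - t * p y.
have pF (t : R) x : 0 <= t -> - p (- x) <= F t x.
  rewrite le_eqVlt => /predU1P[<-|t0].
    by rewrite /F scale0r mul0r addr0 subr0 sublinearN.
  rewrite /F; have := sp.1 (x + t *: y) (- x).
  by rewrite addrAC subrr add0r sp.2// => ?; lra.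
have [|||sp' p'F] := @sublinear_inf R [set t | 0 <= t] F _ _ pF.
- by exists 0 => /=.
- move=> i j x z /= i0 j0; exists (i + j); rewrite /= ?addr_ge0// /F.
  have := sp.1 (x + i *: y) (z + j *: y).
  by rewrite addrACA -scalerDl => ?; lra.
- move=> i s x /= i0 s0; exists (s * i); rewrite /= ?mulr_ge0 ?(ltW s0)// /F.
  by rewrite -scalerA -scalerDr sp.2// -mulrA -mulrBr.
exists (fun x => inf [set F t x | t in [set t | 0 <= t]]); split=> //.
  by move=> x; apply: (le_trans (p'F 0 x _)); rewrite //= /F scale0r mul0r addr0 subr0.
apply: (le_trans (p'F 1 _ _)); rewrite //= /F scale1r addNr (sublinear0 sp).
by rewrite mul1r sub0r.
Qed.

(* A minimal sublinear functional is linear: tilting it along [y] cannot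
   decrease it, so [p (- y) <= - p y]. *)
Lemma hahn_banach q x0 : sublinear q ->
  exists f : {linear V -> R^o}, (forall x, f x <= q x) /\ f x0 = q x0.
Proof.
(* Tilting along [x0] first forces equality there: a linear functional below [q'] satisfies
   [f (- x0) <= - q x0]. *)
move=> sq; have [q' [sq' q'q q'x0]] := sublinear_tilt x0 sq.
have [p [sp pq' pmin]] := minimal_sublinear sq'.
have pN y : p (- y) = - p y.
  have [p' [sp' p'p p'y]] := sublinear_tilt y sp.
  apply/eqP; rewrite eq_le -{1}(pmin p' sp' p'p) p'y/=.
  by rewrite lerNl; exact: sublinearN.
have pD x y : p (x + y) = p x + p y.
  apply/eqP; rewrite eq_le sp.1/=.
  by have := sp.1 (- x) (- y); rewrite -opprD !pN => ?; lra.
have pZ s x : p (s *: x) = s * p x.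
  have [s0|s0|->] := ltgtP s 0; last by rewrite scale0r mul0r (sublinear0 sp).
    by rewrite -[s]opprK scaleNr pN sp.2 ?oppr_gt0// !mulNr.
  by rewrite sp.2.
have plin : linear (p : V -> R^o) by move=> a x y; rewrite pD pZ.
pose f : {linear V -> R^o} := HB.pack (p : V -> R^o)
  (GRing.isLinear.Build _ _ _ _ _ plin).
exists f; split=> [x|]; first exact: le_trans (pq' x) (q'q x).
apply/eqP; rewrite eq_le; apply/andP; split.
  exact: le_trans (pq' x0) (q'q x0).
by have := le_trans (pq' (- x0)) q'x0; rewrite pN lerN2.
Qed.

End HahnBanach.

(** * Functionals on a normed space *)

Section LinSpan.
Variables (R : realType) (V : lmodType R).
Implicit Type A : set V.

Lemma lin_span_subset A (B : set V) : A `<=` B -> lin_span A `<=` lin_span B.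
Proof. by move=> AB x [n [c [v [Av ->]]]]; exists n, c, v; split=> // i; exact/AB. Qed.

Lemma lin_spanD_generator A x (a : R) y :
  lin_span A x -> A y -> lin_span A (x + a *: y).
Proof.
move=> [n [c [v [Av ->]]]] Ay.
exists n.+1, (fun i => if unlift ord0 i is Some j then c j else a),
  (fun i => if unlift ord0 i is Some j then v j else y); split.
  by move=> i; case: unliftP.
rewrite big_ord_recl unlift_none addrC; congr (_ + _).
by apply: eq_bigr => i _; rewrite liftK.
Qed.

End LinSpan.

Section DualFunctionals.
Variables (R : realType) (V : normedModType R).

Lemma linear_bound_continuous (W : normedModType R) (f : {linear V -> W}) (C : R) :
  (forall x, `|f x| <= C * `|x|) -> continuous f.
Proof.
move=> fC; apply/linear_bounded_continuous/bounded_funP => r.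
exists (`|C| * `|r|) => x xr; apply: (le_trans (fC x)).
apply: (@le_trans _ _ (`|C| * `|x|)); first by rewrite ler_wpM2r// ler_norm.
by rewrite ler_wpM2l//; apply: le_trans xr (ler_norm r).
Qed.

(** A one-sided bound suffices, since replacing [x] by [- x] turns it into a bound on [|f x|]. *)
Lemma dual_of_bound (f : {linear V -> R^o}) (C : R) :
  0 <= C -> (forall x, f x <= C * `|x|) ->
  exists2 g : dual V, (forall x, g x = f x) & `|g| <= C.
Proof.
move=> C0 fC.
have fCN x : `|f x| <= C * `|x|.
  rewrite ler_norml fC andbT lerNl -[leLHS](linearN f).
  by rewrite -[`|x|]normrN; exact: fC.
have fP : (f : V -> R^o) \in @dual_pred R V.
  rewrite inE; split; first exact: linearP.
  exact: linear_bound_continuous fCN.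
exists (Dual fP) => //; apply: opnorm_le => x x1 /=.
by apply: (le_trans (fCN x)); rewrite ler_piMr.
Qed.

Lemma dual_le (f : dual V) (C : R) :
  0 <= C -> (forall x, f x <= C * `|x|) -> `|f| <= C.
Proof.
move=> C0 fC; have [g gf] := dual_of_bound C0 fC.
by have -> // : f = g by apply/val_inj/funext => x /=; rewrite gf.
Qed.

Lemma dual_ler (f : dual V) x : f x <= `|f| * `|x|.
Proof. exact: le_trans (ler_norm _) (dual_norm_bound f x). Qed.

Lemma norming_functional (x : V) : exists2 f : dual V, f x = `|x| & `|f| <= 1.
Proof.
have sn : sublinear (fun z : V => `|z|).
  split; first exact: ler_normD.
  by move=> s z s0; rewrite normrZ gtr0_norm.
have [f [fn fx]] := hahn_banach x sn.
have [|g gf g1] := @dual_of_bound f 1 ler01.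
  by move=> z; rewrite mul1r.
by exists g => //; rewrite gf.
Qed.

Lemma dual_separates (x : V) : (forall f : dual V, f x = 0) -> x = 0.
Proof.
have [f fx _] := norming_functional x; move=> /(_ f); rewrite fx.
by move=> /normr0_eq0.
Qed.

Lemma dual_addE (f g : dual V) x : (f + g) x = f x + g x. Proof. by []. Qed.

Lemma dual_scaleE a (f : dual V) x : (a *: f) x = a * f x. Proof. by []. Qed.

Lemma dual_oppE (f : dual V) x : (- f) x = - f x. Proof. by []. Qed.

Lemma dual_sumE n (f : nat -> dual V) x :
  (\sum_(0 <= k < n) f k) x = \sum_(0 <= k < n) f k x.
Proof. by rewrite (big_morph (fun g : dual V => g x) (id1 := 0) (op1 := +%R)). Qed.

(** Induction on [s]. If [a] already lies in the span of the other vectors, their functional works.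
    Otherwise take [g] with [g a = 1] vanishing on [s], apply the induction hypothesis to
    [w - g w a], and correct the result [f] to [f - f a g]. *)
Lemma dual_triangular (s : seq V) (w : V) :
  ~ lin_span [set` s] w ->
  exists2 f : dual V, f w = 1 & forall x, x \in s -> f x = 0.
Proof.
elim: s w => [|a s IH] w ws.
  have w0 : w != 0.
    apply/eqP => w0; apply: ws; exists 0, (fun=> 0), (fun=> 0).
    by split=> [[]//|]; rewrite big_ord0.
  have [f fw _] := norming_functional w.
  exists (`|w|^-1 *: f); last by move=> x; rewrite in_nil.
  by rewrite dual_scaleE fw mulVf ?normr_eq0.
have [[n [c [v [sv av]]]]|/IH[g ga gs]] := pselect (lin_span [set` s] a).
  have [|f fw fs] := IH w.
    by apply: contra_not ws; apply: lin_span_subset => x /= xs; rewrite inE xs orbT.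
  exists f => // x /[1!inE] /predU1P[->|]; last exact: fs.
  rewrite av linear_sum big1// => i _.
  by rewrite linearZ /= fs ?scaler0//; exact: sv.
have [|f fw fs] := IH (w - g w *: a).
  apply: contra_not ws => ws; rewrite -[w](subrK (g w *: a)).
  apply: lin_spanD_generator; last by rewrite /= mem_head.
  by apply: lin_span_subset ws => x /= xs; rewrite inE xs orbT.
exists (f - f a *: g).
  rewrite dual_addE dual_oppE dual_scaleE mulrC.
  by move: fw; rewrite linearB linearZ.
move=> x; rewrite inE dual_addE dual_oppE dual_scaleE => /predU1P[->|xs].
  by rewrite ga mulr1 subrr.
by rewrite fs// gs// mulr0 subr0.
Qed.

End DualFunctionals.

(** The sign condition forces the kernel of [phi] into the kernel of [psi], which makes [psi] a
    multiple of [phi]; the factor is the value of [psi] where [phi] is 1. *)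
Lemma proportional_functionals (R : realFieldType) (F : lmodType R)
    (phi psi : {linear F -> R^o}) :
    (forall f, 0 <= phi f * psi f) -> (exists f, phi f != 0) ->
  exists2 a : R, 0 <= a & forall f, psi f = a * phi f.
Proof.
move=> pp [f1 f1n].
have [f0 pf0] : exists f0, phi f0 = 1.
  by exists ((phi f1)^-1 *: f1); rewrite linearZ; exact: mulVf.
have a0 : 0 <= psi f0 by have := pp f0; rewrite pf0 mul1r.
have ker g : phi g = 0 -> psi g = 0.
  move=> pg; apply/eqP; apply: contraT => psig.
  (* At this point [phi] is 1 and [psi] is -1, against the sign condition. *)
  have := pp (f0 - ((psi f0 + 1) / psi g) *: g).
  have E (h : {linear F -> R^o}) t : h (f0 - t *: g) = h f0 - t * h g.
    by rewrite linearB linearZ.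
  by rewrite !E pf0 pg mulr0 subr0 mul1r divfK//; lra.
exists (psi f0) => // f.
have E (h : {linear F -> R^o}) t : h (f - t *: f0) = h f - t * h f0.
  by rewrite linearB linearZ.
have /ker/eqP : phi (f - phi f *: f0) = 0 by rewrite E pf0 mulr1 subrr.
by rewrite E subr_eq0 mulrC => /eqP.
Qed.

Lemma normD_eq_mul_ge0 (R : realDomainType) (a b : R) :
  `|a| + `|b| <= `|a + b| -> 0 <= a * b.
Proof.
case: (ger0P a) => a0; case: (ger0P b) => b0; case: (ger0P (a + b)) => ab abn;
  nra.
Qed.

(** * Strict convexity of the Read norm *)

Section StrictConvexity.
Variable R : realType.

Lemma continuous_mul (T : topologicalType) (u v : T -> R^o) :
  continuous u -> continuous v -> continuous (fun x => u x * v x : R^o).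
Proof. by move=> cu cv x; apply: cvgM; [exact: cu|exact: cv]. Qed.

(** The midpoint of a segment in the sphere gives [|x + y| = 2], equality in the triangle
    inequality; two unit vectors on one ray coincide. *)
Lemma strictly_convex_of (V : normedModType R) :
  (forall x y : V, `|x| + `|y| <= `|x + y| -> x != 0 ->
     exists2 a : R, 0 <= a & y = a *: x) -> strictly_convex V.
Proof.
move=> cV x y xy.
have x1 : `|x| = 1.
  by have := xy 0; rewrite subr0 scale1r scale0r addr0 lexx ler01; exact.
have y1 : `|y| = 1.
  by have := xy 1; rewrite subrr scale1r scale0r add0r lexx ler01; exact.
have xy2 : `|x| + `|y| <= `|x + y|.
  have := xy 2^-1; have -> : 1 - 2^-1 = 2^-1 :> R by lra.
  have half01 : 0 <= (2^-1 : R) <= 1 by lra.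
  by move=> /(_ half01); rewrite -scalerDr normrZ ger0_norm ?x1 ?y1; lra.
have [|a a0 yE] := cV x y xy2; first by rewrite -normr_eq0 x1 oner_neq0.
by move: y1; rewrite yE normrZ x1 mulr1 ger0_norm// => ->; rewrite scale1r.
Qed.

(** The slack [d] of the triangle inequality in coordinate [k] is lost from every partial sum past
    [k], hence from the norm, so it cannot be positive. *)
Lemma ell1_normD_eq (u w : ell1 R) k : `|u| + `|w| <= `|u + w| -> 0 <= u k * w k.
Proof.
move=> uw; apply: normD_eq_mul_ge0.
pose d := `|u k| + `|w k| - `|u k + w k|.
have partial n : (k < n)%N ->
    \sum_(0 <= i < n) `|(u + w) i| <= `|u| + `|w| - d.
  move=> kn; have := lerD (ell1_norm_ge u n) (ell1_norm_ge w n).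
  rewrite -[ell1_norm u]/(`|u|) -[ell1_norm w]/(`|w|).
  suff : \sum_(0 <= i < n) `|(u + w) i| <=
      \sum_(0 <= i < n) `|u i| + \sum_(0 <= i < n) `|w i| - d by lra.
  rewrite -big_split/= !big_mkord (bigD1 (Ordinal kn))//=.
  rewrite [in leRHS](bigD1 (Ordinal kn))//= [leRHS]addrAC; apply: lerD.
    by rewrite /d subKr.
  by apply: ler_sum => i _; exact: ler_normD.
suff : `|u + w| <= `|u| + `|w| - d by rewrite /d => ?; lra.
apply: ell1_norm_le => n; apply: le_trans (partial (maxn n k.+1) _).
  rewrite (big_cat_nat (leq0n n) (leq_maxl n k.+1))//= lerDl.
  by apply: sumr_ge0.
by rewrite leq_max ltnSn orbT.
Qed.

Lemma dual_evaluation (V : normedModType R) (x : V) :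
  exists Phi : dual (dual V), forall f, Phi f = f x.
Proof.
have evl : linear (fun f : dual V => f x : R^o) by [].
pose ev : {linear dual V -> R^o} :=
  HB.pack (fun f : dual V => f x : R^o) (GRing.isLinear.Build _ _ _ _ _ evl).
have [|g gE _] := @dual_of_bound _ _ ev `|x| (normr_ge0 x).
  by move=> f; rewrite mulrC; exact: dual_ler.
by exists g.
Qed.

Lemma weak_star_evaluation_continuous (X : normedModType R) (x : X) :
  continuous ((fun f : dual X => f x) : weak_star X -> R^o).
Proof.
move=> f; apply: (@continuous_comp (weak_star X) {ptws X -> R^o} R^o
  (fun f : dual X => f : {ptws X -> R^o}) (fun h => h x)).
  exact: initial_continuous.
exact: (@proj_continuous X (fun=> R^o) x).
Qed.

(** The set [C] of good [f] is norm closed and stable under positive scaling, so it passes from the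
    [v_n] to their normalisations, to the sphere of the range, and to the range. It is stated for
    functionals on [dual X] so that it serves both [X], through evaluations, and the bidual. *)
Lemma sphere_dense_mul_ge0 (X : normedModType R) (D : read_construction X)
    (Phi Psi : dual (dual X)) :
    (forall n, 0 <= Phi (rc_v D n) * Psi (rc_v D n)) ->
  forall f, range (rc_T D) f -> 0 <= Phi f * Psi f.
Proof.
move=> pos; pose C := [set f : dual X | 0 <= Phi f * Psi f].
have cC : closed C.
  apply: (@closed_comp _ _ (fun f => Phi f * Psi f) [set t | 0 <= t]).
    by move=> f _; apply: continuous_mul; exact: dual_continuous.
  exact: closed_ge.
have CZ f (a : R) : 0 < a -> C (a *: f) -> C f.
  move=> a0; rewrite /C/= !linearZ/= -[_ *: Phi f]/(_ * _) -[_ *: Psi f]/(_ * _).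
  by rewrite mulrACA pmulr_rge0// mulr_gt0.
move=> f Yf; have [->|f0] := eqVneq f 0; first by rewrite !linear0 mulr0.
have nf : 0 < `|f|^-1 by rewrite invr_gt0 normr_gt0.
apply: (CZ f _ nf); move/closure_id: cC => ->.
apply: closureS (rc_sphere_dense _); last first.
  split; last by rewrite normrZ gtr0_norm// mulVf ?normr_eq0.
  by case: Yf => a _ <-; exists (`|rc_T D a|^-1 *: a) => //; rewrite linearZ.
move=> _ [n _ <-]; have [->|v0] := eqVneq (rc_T D (ell1_delta R n)) 0.
  by rewrite scaler0 /C/= !linear0 mulr0.
apply: (CZ _ `|rc_T D (ell1_delta R n)|); first by rewrite normr_gt0.
by rewrite scalerA mulfV ?normr_eq0// scale1r; exact: pos.
Qed.

Lemma read_norm_strictly_convex (X : normedModType R) (D : read_construction X) :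
  strictly_convex (renorm (read_norm D)).
Proof.
apply: strictly_convex_of => x y; rewrite !renormE /= /read_norm_fun => xy x0.
have RD : rc_R D (x + y) = rc_R D x + rc_R D y.
  by apply/val_inj/funext => n /=; rewrite linearD mulrDr.
(* The triangle inequality for the original norm leaves all of the equality to the [l_1] part. *)
have sumR : `|rc_R D x| + `|rc_R D y| <= `|rc_R D x + rc_R D y|.
  by have := ler_normD (x : X) (y : X); rewrite -RD; lra.
have [Phi PhiE] := dual_evaluation (x : X).
have [Psi PsiE] := dual_evaluation (y : X).
have v_ge0 n : 0 <= Phi (rc_v D n) * Psi (rc_v D n).
  have := ell1_normD_eq n sumR; rewrite PhiE PsiE /= mulrACA pmulr_rge0//.
  by rewrite mulr_gt0// rc_r_gt0.
have f_ge0 f : 0 <= Phi f * Psi f.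
  rewrite leNgt; apply/negP => f0.
  (* This set is weak-star open and contains [f], so by density it would contain an element of the
     range of [T]. *)
  pose O := [set g : weak_star X | (g : dual X) x * (g : dual X) y < 0].
  have oO : open O.
    apply: (@open_comp _ _ (fun g : weak_star X => (g : dual X) x * (g : dual X) y)
      [set t | t < 0]); last exact: open_lt.
    by move=> g _; apply: continuous_mul; exact: weak_star_evaluation_continuous.
  have [|g [Og Yg]] := rc_dense D _ oO.
    by exists f; rewrite /O/= -PhiE -PsiE.
  have := sphere_dense_mul_ge0 v_ge0 Yg; rewrite PhiE PsiE leNgt => /negP; exact.
have [|a a0 psiE] := proportional_functionals f_ge0.
  apply: contrapT => /forallNP Phi0; move/eqP: x0; apply.
  apply: (@dual_separates R X) => f; rewrite -PhiE.
  by apply/eqP; have := Phi0 f; case: eqP.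
exists a => //; apply/eqP; rewrite -subr_eq0; apply/eqP.
apply: (@dual_separates R X) => f.
by rewrite linearB linearZ /= -PhiE -PsiE psiE subrr.
Qed.

End StrictConvexity.

(** * Smoothness from strict convexity of the dual *)

Section Smoothness.
Variables (R : realType) (V : normedModType R).

Definition diff_quotient (x : V) (t : R) (h : V) : R := (`|x + t *: h| - `|x|) / t.

(** The right-hand derivative of the norm at [x]: by convexity the quotients decrease with [t], so
    their infimum is the limit at [0+]. *)
Definition upper_derivative (x h : V) : R :=
  inf [set diff_quotient x t h | t in [set t | 0 < t]].

Lemma diff_quotient_le (x h : V) (s t : R) : 0 < s -> s <= t ->
  diff_quotient x s h <= diff_quotient x t h.
Proof.
move=> s0 st; have t0 := lt_le_trans s0 st.
rewrite /diff_quotient ler_pdivrMr// mulrAC ler_pdivlMr//.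
have := ler_normD ((t - s) *: x) (s *: (x + t *: h)).
rewrite !normrZ (ger0_norm (ltW s0)) ger0_norm ?subr_ge0//.
have -> : (t - s) *: x + s *: (x + t *: h) = t *: (x + s *: h).
  by rewrite !scalerDr scalerBl addrA subrK !scalerA mulrC.
rewrite normrZ gtr0_norm// => ?; lra.
Qed.

Lemma upper_derivative_sublinear (x : V) : sublinear (upper_derivative x) /\
  forall (t : R) h, 0 < t -> upper_derivative x h <= diff_quotient x t h.
Proof.
apply: (@sublinear_inf R V R [set t | 0 < t] (diff_quotient x) (fun h => - `|h|)).
- by exists 1; rewrite /= ltr01.
- move=> t h /= t0; rewrite /diff_quotient ler_pdivlMr//.
  have := lerB_normD x (t *: h); rewrite normrZ gtr0_norm// => ?; lra.
- move=> s t h k /= s0 t0; have st0 : 0 < s + t by rewrite addr_gt0.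
  (* With this increment the point is the convex combination of [x + s h] and [x + t k] with weights
     [t / (s + t)] and [s / (s + t)]. *)
  exists (s * t / (s + t)); first by rewrite /= divr_gt0// mulr_gt0.
  rewrite /diff_quotient.
  have cvx : `|x + (s * t / (s + t)) *: (h + k)| <=
      t / (s + t) * `|x + s *: h| + s / (s + t) * `|x + t *: k|.
    have -> : x + (s * t / (s + t)) *: (h + k) =
        (t / (s + t)) *: (x + s *: h) + (s / (s + t)) *: (x + t *: k).
      rewrite !scalerDr !scalerA addrACA -scalerDl.
      have -> : t / (s + t) + s / (s + t) = 1 by field; rewrite gt_eqF.
      by rewrite scale1r; congr (_ + (_ *: _ + _ *: _)); field; rewrite gt_eqF.
    apply: (le_trans (ler_normD _ _)); rewrite !normrZ.
    by rewrite (gtr0_norm t0) (gtr0_norm s0) gtr0_norm ?invr_gt0.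
  rewrite ler_pdivrMr; last by rewrite divr_gt0// mulr_gt0.
  have -> : ((`|x + s *: h| - `|x|) / s + (`|x + t *: k| - `|x|) / t) *
      (s * t / (s + t)) =
     t / (s + t) * `|x + s *: h| + s / (s + t) * `|x + t *: k| - `|x|.
    by field; rewrite !gt_eqF.
  by rewrite lerB.
- move=> t s h /= t0 s0; exists (t / s); first by rewrite /= divr_gt0.
  rewrite /diff_quotient scalerA divfK ?gt_eqF//.
  by rewrite invf_div mulrCA.
Qed.

(** Hahn-Banach below the upper derivative: that derivative is at most the norm, which gives
    [|L| <= 1], and its value at [- x] is at most [- |x|], which gives [L x = |x|]. *)
Lemma support_functional (x h : V) : x != 0 -> exists2 L : dual V,
  (forall k, L k <= upper_derivative x k) /\ L h = upper_derivative x h &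
  `|L| <= 1 /\ L x = `|x|.
Proof.
move=> x0; have [sq qle] := upper_derivative_sublinear x.
have [f [fq fh]] := hahn_banach h sq.
have qn k : upper_derivative x k <= `|k|.
  apply: (le_trans (qle 1 k ltr01)).
  rewrite /diff_quotient scale1r divr1; have := ler_normD x k => ?; lra.
have [|L Lf L1] := @dual_of_bound _ _ f 1 ler01.
  by move=> k; rewrite mul1r; exact: le_trans (fq k) (qn k).
exists L; first by split=> [k|]; rewrite Lf.
split=> //; apply/eqP; rewrite eq_le; apply/andP; split.
  apply: (le_trans (dual_ler _ _)); by rewrite ler_piMl.
have := le_trans (fq (- x)) (qle 1 (- x) ltr01).
rewrite /diff_quotient scale1r subrr normr0 divr1 linearN Lf => ?; lra.
Qed.

(** Every convex combination of [L] and [M] still supports the ball at [x], so the segment joining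
    them lies in the dual sphere. *)
Lemma support_functional_unique (x : V) (L M : dual V) :
  strictly_convex (dual V) -> x != 0 -> `|L| <= 1 -> `|M| <= 1 ->
  L x = `|x| -> M x = `|x| -> L = M.
Proof.
move=> sc x0 L1 M1 Lx Mx; apply: sc => t /andP[t0 t1].
have nx : 0 < `|x| by rewrite normr_gt0.
apply/eqP; rewrite eq_le; apply/andP; split.
  apply: (le_trans (ler_normD _ _)); rewrite !normrZ !ger0_norm ?subr_ge0//.
  by nra.
have := dual_ler ((1 - t) *: L + t *: M) x.
rewrite dual_addE !dual_scaleE Lx Mx -mulrDl subrK mul1r.
by rewrite -[X in X <= _]mul1r ler_pM2r.
Qed.

(* Hahn-Banach attains both one-sided derivatives of the norm at [x] by
   functionals supporting the ball at [x], and there is only one of these. *)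
Lemma smooth_of_strictly_convex_dual : strictly_convex (dual V) -> smooth V.
Proof.
move=> sc x x0; have [sq qle] := upper_derivative_sublinear x.
have [L [Lq _] [L1 Lx]] := support_functional 0 x0.
have Lder k : L k = upper_derivative x k.
  have [M [_ <-] [M1 Mx]] := support_functional k x0.
  by rewrite (support_functional_unique sc x0 L1 M1 Lx Mx).
have approx k (e : R) : 0 < e -> exists2 t : R, 0 < t & diff_quotient x t k <= L k + e.
  move=> e0; rewrite Lder.
  have [|_ [t t0 <-] /ltW] := @inf_adherent _
      [set diff_quotient x t k | t in [set t | 0 < t]] e e0.
    split; first by exists (diff_quotient x 1 k), 1 => //=.
    by exists (upper_derivative x k) => _ [t t0 <-]; exact: qle.
  by exists t.
exists L => h.
have lim : (fun t : R => t^-1 *: (`|t *: h + x| - `|x| : R^o)) @ 0^' --> (L h : R^o).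
  apply/cvgrPdist_le => e e0.
  have [t1 t10 q1] := approx h e e0.
  have [t2 t20 q2] := approx (- h) e e0.
  near=> t; have tn0 : t != 0 by near: t; exact: nbhs_dnbhs_neq.
  have tle : `|t| <= Num.min t1 t2.
    near: t; apply: dnbhs0_le; by rewrite lt_min t10.
  move: tle; rewrite le_min => /andP[tt1 tt2].
  have -> : t^-1 *: (`|t *: h + x| - `|x| : R^o) = (`|x + t *: h| - `|x|) / t.
    by rewrite [t *: h + x]addrC; exact: mulrC.
  rewrite ler_distlC.
  (* For [t > 0] monotonicity puts the quotient between [L h] and [L h + e]. For [t < 0] it is minus
     the quotient for [- t] in the direction [- h]. *)
  have [tpos|tneg] := ltP 0 t.
    have dt := le_trans (@diff_quotient_le x h t t1 tpos (le_trans (ler_norm t) tt1)) q1.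
    have := qle t h tpos; rewrite -Lder -/(diff_quotient x t h) => ?.
    by apply/andP; split; lra.
  have tneg' : 0 < - t by rewrite oppr_gt0 lt_neqAle tn0.
  have tt2' : - t <= t2 by apply: le_trans tt2; rewrite -normrN ler_norm.
  have dt := le_trans (@diff_quotient_le x (- h) (- t) t2 tneg' tt2') q2.
  have := qle (- t) (- h) tneg'; rewrite -Lder.
  have -> : (`|x + t *: h| - `|x|) / t = - diff_quotient x (- t) (- h).
    by rewrite /diff_quotient scalerN scaleNr opprK invrN mulrN opprK.
  move: dt; rewrite linearN => dt ?.
  by apply/andP; split; lra.
split; first exact: cvgP lim.
exact: cvg_lim lim.
Unshelve. all: by end_near.
Qed.

End Smoothness.

(** * The bidual of the Read norm *)

(* The one-dimensional Hahn-Banach step: the admissible [b] form the interval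
   between [sup (f x - p x)] over [v x = 1] and [inf (p y - f y)] over
   [v y = - 1]. *)
Lemma peel_functional (R : realType) (V : lmodType R) (f v : {linear V -> R^o})
    (p : V -> R) : sublinear p -> (forall x, f x <= p x + `|v x|) ->
  exists2 b : R, `|b| <= 1 & forall x, f x - b * v x <= p x.
Proof.
move=> sp fpv.
have scale (h : {linear V -> R^o}) (s : R) x : h (s *: x) = s * h x by rewrite linearZ.
have [[z vz]|/forallNP v0] := pselect (exists z, v z != 0); last first.
  exists 0 => [|x]; first by rewrite normr0.
  have /negP/negPn/eqP vx := v0 x.
  by have := fpv x; rewrite vx normr0 mulr0; lra.
pose S := [set f x - p x | x in [set x | v x = 1]].
have S0 : S !=set0.
  by exists (f ((v z)^-1 *: z) - p ((v z)^-1 *: z)), ((v z)^-1 *: z);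
    rewrite //= scale mulVf.
have S1 : ubound S 1.
  by move=> _ [x /= vx <-]; have := fpv x; rewrite vx normr1; lra.
have supS : has_sup S by split=> //; exists 1.
have opp x y : v x = 1 -> v y = -1 -> f x - p x <= p y - f y.
  move=> vx vy; have := fpv (x + y).
  rewrite !linearD /= vx vy subrr normr0 addr0 => ?.
  by have := sp.1 x y; lra.
have opp1 y : v y = -1 -> -1 <= p y - f y.
  by move=> vy; have := fpv y; rewrite vy normrN normr1; lra.
(* The cut-off at -1 ensures [|b| <= 1]; by [opp1] it respects the upper constraints. *)
exists (Num.max (sup S) (-1)).
  rewrite ler_norml le_max lexx orbT/= ge_max ge_sup//=; lra.
set b := Num.max _ _ => x.
have [vx|vx|vx] := ltgtP (v x) 0; last first.
- by have := fpv x; rewrite vx normr0 mulr0; lra.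
- have : f ((v x)^-1 *: x) - p ((v x)^-1 *: x) <= b.
    rewrite le_max ub_le_sup//; first exact: supS.2.
    by exists ((v x)^-1 *: x); rewrite //= scale mulVf ?gt_eqF.
  rewrite scale sp.2 ?invr_gt0// -mulrBr ler_pdivrMl// => ?; lra.
- have vy : v ((- (v x)^-1) *: x) = -1 by rewrite scale mulNr mulVf ?lt_eqF.
  have : b <= p ((- (v x)^-1) *: x) - f ((- (v x)^-1) *: x).
    rewrite ge_max opp1// andbT; apply: ge_sup => // _ [y /= y1 <-].
    exact: opp.
  have nvx : 0 < - v x by rewrite oppr_gt0.
  by rewrite scale -invrN sp.2 ?invr_gt0// -mulrBr ler_pdivlMl//; lra.
Qed.

(** Peel off one [w k] at a time: each removes a multiple [b w k] with [|b| <= 1], and what remains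
    of [f] has dual norm at most [C]. *)
Lemma bidual_bound (R : realType) (X : normedModType R)
    (Phi : {linear dual X -> R^o}) (A C : R) (w : nat -> dual X) N (f : dual X) :
    0 <= C -> (forall g, `|Phi g| <= A * `|g|) ->
    (forall x, f x <= C * `|x| + \sum_(0 <= k < N) `|w k x|) -> 0 <= A ->
  `|Phi f| <= A * C + \sum_(0 <= k < N) `|Phi (w k)|.
Proof.
move=> C0 PhiA + A0; elim: N f => [|N IH] f fw.
  rewrite big_geq// addr0; apply: (le_trans (PhiA f)); rewrite ler_wpM2l//.
  by apply: dual_le => // x; have := fw x; rewrite big_geq// addr0.
pose p x := C * `|x| + \sum_(0 <= k < N) `|w k x|.
have sp : sublinear p.
  split=> [x y|s x s0]; rewrite /p.
    rewrite addrACA -mulrDr -big_split/=; apply: lerD.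
      by rewrite ler_wpM2l// ler_normD.
    by apply: ler_sum => k _; rewrite linearD; exact: ler_normD.
  rewrite normrZ gtr0_norm// mulrDr mulrCA mulr_sumr; congr (_ + _).
  apply: eq_bigr => k _; rewrite linearZ -[in RHS](gtr0_norm s0).
  exact: normrM.
have [|b b1 fb] := @peel_functional _ _ f (w N) p sp.
  by move=> x; have := fw x; rewrite big_nat_recr//= addrA.
have fbE x : (f - b *: w N) x = f x - b * w N x by [].
have /IH fle x : (f - b *: w N) x <= p x by rewrite fbE; exact: fb.
have -> : Phi f = Phi (f - b *: w N) + b * Phi (w N).
  by rewrite linearB linearZ subrK.
rewrite big_nat_recr//= addrA; apply: (le_trans (ler_normD _ _)).
by apply: lerD => //; rewrite normrM ler_piMl.
Qed.

(** * Functionals on the renormed space *)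

Section RenormDual.
Variables (R : realType) (X : normedModType R) (p : equiv_norm X).

Lemma renorm_dual_subproof (g : dual X) :
  (g : renorm p -> R^o) \in @dual_pred R (renorm p).
Proof.
have gl : linear (g : renorm p -> R^o) by move=> a x y; exact: (dual_linear g a x y).
pose h : {linear renorm p -> R^o} :=
  HB.pack (g : renorm p -> R^o) (GRing.isLinear.Build _ _ _ _ _ gl).
have [c [C [c0 _ pc]]] := equiv_norm_bounds p.
rewrite inE; split=> //; apply: (@linear_bound_continuous _ _ _ h (`|g| / c)) => x.
apply: (le_trans (dual_norm_bound g x)); rewrite -mulrA ler_wpM2l ?opnorm_ge0//.
by rewrite ler_pdivlMl//; case/andP: (pc x).
Qed.

(** The formal identity between the duals of [X] and [(X, p)], which have the same elements but
    different norms. *)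
Definition renorm_dual (g : dual X) : dual (renorm p) := Dual (renorm_dual_subproof g).

Lemma renorm_dual_linear : linear renorm_dual.
Proof. by move=> a f g; apply/val_inj/funext. Qed.

HB.instance Definition _ :=
  GRing.isLinear.Build R (dual X) (dual (renorm p)) _ renorm_dual renorm_dual_linear.

Lemma renorm_dual_surj (f : dual (renorm p)) : exists g, renorm_dual g = f.
Proof.
have fl : linear (f : X -> R^o) by move=> a x y; exact: (dual_linear f a x y).
pose h : {linear X -> R^o} := HB.pack (f : X -> R^o)
  (GRing.isLinear.Build _ _ _ _ _ fl).
have [c [C [_ C0 pc]]] := equiv_norm_bounds p.
have [||g gE _] := @dual_of_bound _ _ h (`|f| * C).
- by rewrite mulr_ge0 ?(ltW C0).
- move=> x; apply: (le_trans (dual_ler f x)).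
  by rewrite -mulrA ler_wpM2l//; case/andP: (pc x).
by exists g; apply/val_inj/funext.
Qed.

End RenormDual.

(** * Two-sided estimates of the bidual norm *)

Section ReadBidual.
Variables (R : realType) (X : normedModType R) (D : read_construction X).
Local Notation p := (read_norm D).
Local Notation r := (rc_r D).
Local Notation v := (rc_v D).
Local Notation J := (renorm_dual p).
Implicit Types Phi Psi : dual (dual (renorm p)).

Definition rc_tail n : R := limn (series r) - series r n.

Lemma rc_tail_cvg0 : rc_tail @ \oo --> (0 : R).
Proof.
by rewrite -(subrr (limn (series r)));
  apply: cvgB; [exact: cvg_cst|exact: rc_r_summable].
Qed.

Lemma rc_tail_ge0 n : 0 <= rc_tail n.
Proof.
rewrite subr_ge0; apply: nondecreasing_cvgn_le; last exact: rc_r_summable.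
by apply: nondecreasing_series => k _ _; exact/ltW/rc_r_gt0.
Qed.

(** Truncates [p] to finitely many functionals, as [bidual_bound] requires; since [|v k| <= 1], the
    discarded coordinates cost at most the tail of [r] times [|x|]. *)
Lemma read_norm_le_tail N (x : X) :
  p x <= (1 + rc_tail N) * `|x| + \sum_(0 <= k < N) `|(r k *: v k) x|.
Proof.
rewrite mulrDl mul1r -addrA lerD2l; apply: ell1_norm_le => n.
apply: (@le_trans _ _ (\sum_(0 <= k < maxn n N) `|r k * v k x|)).
  rewrite (big_cat_nat (leq0n n) (leq_maxl n N))//= lerDl.
  exact: sumr_ge0.
rewrite (big_cat_nat (leq0n N) (leq_maxr n N))//= addrC lerD2r.
apply: (@le_trans _ _ (\sum_(N <= k < maxn n N) r k * `|x|)).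
  apply: ler_sum => k _; rewrite normrM gtr0_norm ?rc_r_gt0// ler_pM2l ?rc_r_gt0//.
  apply: (le_trans (dual_norm_bound _ _)); rewrite ler_piMl//; exact: rc_v_norm.
rewrite -mulr_suml ler_wpM2r// lerBrDr addrC.
rewrite /series/= -(big_cat_nat (leq0n N) (leq_maxr n N))//=.
apply: (@nondecreasing_cvgn_le _ (series r)); last exact: rc_r_summable.
by apply: nondecreasing_series => k _ _; exact/ltW/rc_r_gt0.
Qed.

(** The upper half of the bidual norm formula, up to an error [A * rc_tail N] that vanishes in the
    limit. *)
Lemma bidual_norm_le Phi (A : R) N : 0 <= A -> (forall g, `|Phi (J g)| <= A * `|g|) ->
  `|Phi| <= A * (1 + rc_tail N) + \sum_(0 <= k < N) r k * `|Phi (J (v k))|.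
Proof.
move=> A0 PhiA; apply: opnorm_le => f; have [g <-] := renorm_dual_surj f => g1.
have -> : \sum_(0 <= k < N) r k * `|Phi (J (v k))| =
    \sum_(0 <= k < N) `|(Phi \o J) (r k *: v k)|.
  apply: eq_bigr => k _ /=; rewrite !linearZ/= -[LHS]/(_ * _) -[_ *: _]/(_ * _) normrM.
  by rewrite (gtr0_norm (rc_r_gt0 D k)).
apply: (@bidual_bound _ _ (Phi \o J) A _ (fun k => r k *: v k)) => //.
  by rewrite addr_ge0 ?rc_tail_ge0.
move=> x; apply: le_trans (read_norm_le_tail N x).
by apply: (le_trans (dual_ler (J g) x)); rewrite ler_piMl.
Qed.

(** The lower half: [Phi] is tested on a signed sum of [g] and the [r k v k], which lies in the dual
    ball of [p]. The signs make each term contribute its absolute value. *)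
Lemma bidual_norm_ge Phi N :
  opnorm (Phi \o J : dual X -> R^o) + \sum_(0 <= k < N) r k * `|Phi (J (v k))| <= `|Phi|.
Proof.
rewrite -lerBrDr; apply: opnorm_le => g g1 /=; rewrite lerBrDr.
pose s (t : R) : R := if 0 <= t then 1 else - 1.
have sE t : s t * t = `|t| by rewrite /s; case: ger0P; rewrite ?mul1r ?mulN1r.
have sn t : `|s t| = 1 by rewrite /s; case: ifP; rewrite ?normrN normr1.
pose f := s (Phi (J g)) *: g + \sum_(0 <= k < N) (s (Phi (J (v k))) * r k) *: v k.
have <- : Phi (J f) = `|Phi (J g)| + \sum_(0 <= k < N) r k * `|Phi (J (v k))|.
  rewrite !linearD !linearZ/= !linear_sum/=; congr (_ + _); first exact: sE.
  apply: eq_bigr => k _; by rewrite !linearZ/= -sE [RHS]mulrCA [RHS]mulrA.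
apply: (le_trans (dual_ler _ _)); rewrite ler_piMr//.
apply: dual_le => // x; rewrite mul1r renormE /= /read_norm_fun.
rewrite -[leLHS]/(f (x : X)); have -> : f (x : X) = s (Phi (J g)) * g x +
    \sum_(0 <= k < N) s (Phi (J (v k))) * r k * v k (x : X).
  by rewrite /f dual_addE dual_sumE.
apply: lerD.
  apply: (le_trans (ler_norm _)); rewrite normrM sn mul1r.
  by apply: (le_trans (dual_norm_bound g x)); rewrite ler_piMl.
apply: le_trans (ell1_norm_ge (rc_R D x) N).
apply: ler_sum => k _; apply: (le_trans (ler_norm _)).
by rewrite -mulrA normrM sn mul1r.
Qed.

Lemma bidual_normD_eq Phi Psi k : `|Phi| + `|Psi| <= `|Phi + Psi| ->
  0 <= Phi (J (v k)) * Psi (J (v k)).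
Proof.
move=> normD; apply: normD_eq_mul_ge0; rewrite -subr_le0.
set d := (X in X <= 0).
pose A := opnorm (Phi \o J : dual X -> R^o) + opnorm (Psi \o J : dual X -> R^o).
have A0 : 0 <= A by rewrite addr_ge0 ?opnorm_ge0.
have J1 g : `|J g| <= `|g|.
  apply: dual_le => // x; apply: (le_trans (dual_ler g x)).
  by rewrite ler_wpM2l// renormE /= /read_norm_fun lerDl.
have bnd (Xi : dual (dual (renorm p))) g :
    `|Xi (J g)| <= opnorm (Xi \o J : dual X -> R^o) * `|g|.
  apply: (opnorm_bound (f := Xi \o J)).
  apply: (@linear_bound_continuous _ _ _ (Xi \o J) `|Xi|) => h.
  by apply: (le_trans (dual_norm_bound Xi _)); exact: ler_wpM2l (normr_ge0 Xi) _ _ (J1 h).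
have sumA g : `|(Phi + Psi) (J g)| <= A * `|g|.
  by apply: (le_trans (ler_normD _ _)); rewrite /A mulrDl; apply: lerD; exact: bnd.
(* Comparing the two halves of the norm formula, the slack [d] at index [k] is paid for by the
   truncation error alone; let [n] tend to infinity. *)
have key n : (k < n)%N -> r k * d <= A * rc_tail n.
  move=> kn; have := bidual_norm_le n A0 sumA.
  have := bidual_norm_ge Phi n; have := bidual_norm_ge Psi n.
  have : \sum_(0 <= i < n) r i * `|(Phi + Psi) (J (v i))| <=
      \sum_(0 <= i < n) r i * `|Phi (J (v i))| +
      \sum_(0 <= i < n) r i * `|Psi (J (v i))| - r k * d.
    rewrite -big_split/= !big_mkord (bigD1 (Ordinal kn))//=.
    rewrite [in leRHS](bigD1 (Ordinal kn))//= [leRHS]addrAC; apply: lerD.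
      by rewrite -mulrDr -mulrBr /d subKr.
    apply: ler_sum => i _; rewrite -mulrDr ler_pM2l ?rc_r_gt0//.
    exact: ler_normD.
  have AE : A =
      opnorm (Phi \o J : dual X -> R^o) + opnorm (Psi \o J : dual X -> R^o) by [].
  rewrite [A * (1 + _)]mulrDr mulr1; move: AE (A * rc_tail n) => AE At *; lra.
have cvgA : (fun n => A * rc_tail n) @ \oo --> (A * 0 : R).
  by apply: cvgM; [exact: cvg_cst|exact: rc_tail_cvg0].
suff : r k * d <= A * 0 by rewrite mulr0 pmulr_rle0// rc_r_gt0.
rewrite -(cvg_lim _ cvgA)//; apply: limr_ge; first exact: cvgP cvgA.
by near=> n; apply: key; near: n; exact: nbhs_infty_gt.
Unshelve. all: by end_near.
Qed.

Lemma read_bidual_strictly_convex : dense (range (rc_T D)) ->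
  strictly_convex (dual (dual (renorm p))).
Proof.
move=> dT; apply: strictly_convex_of => Phi Psi normD Phi0.
(* [Phi] and [Psi] are pulled back to the dual of [X] with its original norm, where the density
   assumptions live. The pullbacks are norm continuous, which is why norm density of the range is
   used below. *)
have dJ (Xi : dual (dual (renorm p))) :
    exists Xi' : dual (dual X), forall g, Xi' g = Xi (J g).
  have [||Xi' Xi'E _] := @dual_of_bound _ _ (Xi \o J) `|Xi|.
  - by [].
  - move=> g; apply: (le_trans (dual_ler Xi _)); rewrite ler_wpM2l//.
    apply: dual_le => // x; apply: (le_trans (dual_ler g x)).
    by rewrite ler_wpM2l// renormE /= /read_norm_fun lerDl.
  - by exists Xi'.
have [Phi' PhiE] := dJ Phi; have [Psi' PsiE] := dJ Psi.
have v_ge0 n : 0 <= Phi' (v n) * Psi' (v n).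
  by rewrite PhiE PsiE; exact: bidual_normD_eq.
have f_ge0 f : 0 <= Phi' f * Psi' f.
  rewrite leNgt; apply/negP => f0.
  have oO : open [set g : dual X | Phi' g * Psi' g < 0].
    apply: (@open_comp _ _ (fun g => Phi' g * Psi' g) [set t | t < 0]).
      by move=> g _; apply: continuous_mul; exact: dual_continuous.
    exact: open_lt.
  have [|g [Og Yg]] := dT _ _ oO; first by exists f.
  by have := sphere_dense_mul_ge0 v_ge0 Yg; rewrite leNgt => /negP; exact.
have [|a a0 psiE] := proportional_functionals f_ge0.
  apply: contrapT => /forallNP Phi'0; move/eqP: Phi0; apply.
  apply/val_inj/funext => f; have [g <-] := renorm_dual_surj f.
  by apply/eqP; have := Phi'0 g; rewrite /= PhiE; case: eqP.
exists a => //; apply/val_inj/funext => f; have [g <-] := renorm_dual_surj f.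
by rewrite /= -PsiE [LHS]psiE /= PhiE.
Qed.

End ReadBidual.

(** * Operators on l_1 with dense range *)

Section Ell1Operators.
Variable R : realType.

(** The series converges absolutely in the complete space [E], dominated by the sum of the
    [|a k|]. *)
Lemma ell1_synthesis (E : completeNormedModType R) (u : nat -> E) :
    (forall n, `|u n| <= 1) ->
  exists S : {linear ell1 R -> E}, (forall a, `|S a| <= `|a|) /\
    forall a : ell1 R, series (fun k => a k *: u k) @ \oo --> S a.
Proof.
move=> u1.
have cS (a : ell1 R) : cvgn (series (fun k => a k *: u k)).
  apply: normed_cvg; apply: (@series_le_cvg _ _ (fun k => `|a k|)) => //.
  - by move=> n /=.
  - by move=> n; rewrite /= normrZ ler_piMr.
  - exact: ell1_cvg.
pose S (a : ell1 R) : E := limn (series (fun k => a k *: u k)).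
have Slin : linear S.
  move=> t a b; apply: cvg_lim => //.
  have -> : series (fun k => (t *: a + b : ell1 R) k *: u k) =
      (fun n => t *: series (fun k => a k *: u k) n + series (fun k => b k *: u k) n).
    apply/funext => n; rewrite /series/= scaler_sumr -big_split/=.
    by apply: eq_bigr => k _; rewrite scalerA -scalerDl.
  by apply: cvgD; [apply: cvgZl_tmp; exact: cS|exact: cS].
pose SL : {linear ell1 R -> E} := HB.pack S (GRing.isLinear.Build _ _ _ _ _ Slin).
exists SL; split=> a /=; last exact: cS.
rewrite -(cvg_lim _ (cvg_norm (cS a)))//; apply: limr_le.
  by apply: is_cvg_norm; exact: cS.
apply: nearW => n; apply: le_trans (ell1_norm_ge a n).
apply: (le_trans (ler_norm_sum _ _ _)); apply: ler_sum => k _.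
by rewrite normrZ ler_piMr.
Qed.

Lemma series_ell1_delta (V : normedModType R) (u : nat -> V) (n : nat) :
  series (fun k => ell1_delta R n k *: u k) @ \oo --> u n.
Proof.
apply: (@cvg_trans _ ((fun=> u n) @ \oo)); last exact: cvg_cst.
apply: near_eq_cvg; near=> m.
have nm : (n < m)%N by near: m; exact: nbhs_infty_gt.
rewrite /series/= big_mkord (bigD1 (Ordinal nm))//= eqxx scale1r big1 ?addr0// => i ni.
by rewrite -(inj_eq val_inj) /= in ni; rewrite (negbTE ni) scale0r.
Unshelve. all: by end_near.
Qed.

Lemma lin_span_fin_range (V : lmodType R) n (v : 'I_n -> V) x :
  lin_span (range v) x -> exists c : 'I_n -> R, x = \sum_(j < n) c j *: v j.
Proof.
move=> [m [c [w [/= wv ->]]]].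
have /choice[k kv] : forall i, exists j, v j = w i.
  by move=> i; have [j _ <-] := wv i; exists j.
exists (fun j => \sum_(i < m | k i == j) c i).
rewrite (partition_big k predT)//=; apply: eq_bigr => j _.
by rewrite scaler_suml; apply: eq_bigr => i /eqP <-; rewrite kv.
Qed.

Lemma ell1_infinite_dim : infinite_dim (ell1 R).
Proof.
move=> [n [v vT]].
have /choice[A AE] : forall i : 'I_n.+1, exists c : 'I_n -> R,
    ell1_delta R i = \sum_(j < n) c j *: v j.
  by move=> i; apply: lin_span_fin_range; rewrite vT.
pose M := \matrix_(i, j) A i j.
(* The coefficient matrix of [n + 1] unit vectors over [n] generators has more rows than columns,
   hence a nonzero left kernel; its elements give vanishing combinations of unit vectors. *)
have /rowV0Pn[c /sub_kermxP cM] : kermx M != 0.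
  by rewrite kermx_eq0 /row_free neq_ltn ltnS rank_leq_col.
apply/negP; rewrite negbK; apply/eqP/rowP => i; rewrite mxE.
have comb0 : \sum_i c 0 i *: ell1_delta R i = 0.
  under eq_bigr do rewrite AE scaler_sumr.
  rewrite exchange_big big1//= => j _.
  under eq_bigr do rewrite scalerA.
  rewrite -scaler_suml; have /rowP/(_ j) := cM; rewrite !mxE => cMj.
  suff -> : \sum_i c 0 i * A i j = 0 by rewrite scale0r.
  by rewrite -[RHS]cMj; apply: eq_bigr => l _; rewrite mxE.
have := congr1 (fun a : ell1 R => a i) comb0.
rewrite (big_morph (fun a : ell1 R => a i) (id1 := 0) (op1 := +%R))//=.
have deltaE l : (c 0 l *: ell1_delta R l : ell1 R) i = c 0 l * ((i : nat) == l)%:R by [].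
rewrite (eq_bigr _ (fun l _ => deltaE l)).
rewrite (bigD1 i)//= eqxx mulr1 big1 ?addr0// => l li.
by rewrite (inj_eq val_inj) eq_sym (negbTE li) mulr0.
Qed.

Lemma max_norm_index (a : nat -> R^o) k : a @ \oo --> (0 : R^o) -> a k != 0 ->
  exists2 N, a N != 0 & forall m, `|a m| <= `|a N|.
Proof.
move=> a0 ak.
have /cvgrPdist_lt/(_ `|a k|) := a0; rewrite normr_gt0 => /(_ ak) [n _ an].
pose F (i : 'I_(maxn n k).+1) := `|a i|.
have kn : (k < (maxn n k).+1)%N by rewrite ltnS leq_maxr.
have [/= i _ imax] := @Order.TotalTheory.arg_maxP _ _ _ (Ordinal kn) predT F isT.
have aki : `|a k| <= `|a i| by exact: (imax (Ordinal kn)).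
exists i => [|m]; first by rewrite -normr_gt0 (lt_le_trans _ aki)// normr_gt0.
have [mn|nm] := ltnP m (maxn n k).+1; first exact: (imax (Ordinal mn)).
apply: le_trans aki; apply: ltW.
have := an m; rewrite /= sub0r normrN; apply.
by apply: leq_trans (ltnW nm); rewrite leq_maxl.
Qed.

(* [phi N] is applied at an index [N] where [`|a N|] is maximal: it kills the
   earlier terms, and the later ones add up to at most [`|a N| / 2]. *)
Lemma triangular_series_eq0 (V : normedModType R) (v : nat -> V)
    (phi : nat -> dual V) (a : ell1 R) :
    (forall n, phi n (v n) = 1) ->
    (forall j n, (j < n)%N -> phi n (v j) = 0) ->
    (forall j n, (j < n)%N -> `|phi j (v n)| <= 2^-1 ^+ n.+1) ->
    series (fun k => a k *: v k) @ \oo --> (0 : V) -> a = 0.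
Proof.
move=> diag lower upper a0; apply/val_inj/funext => k /=.
apply/eqP; apply: contraT => ak.
have /max_norm_index/(_ ak)[N aN Nmax] : (a : nat -> R^o) @ \oo --> (0 : R^o).
  by apply: norm_cvg0; exact: cvg_series_cvg_0 (@ell1_cvg _ a).
have phiE n : phi N (series (fun k => a k *: v k) n) =
    \sum_(0 <= k < n) a k * phi N (v k).
  by rewrite linear_sum; apply: eq_bigr => i _; rewrite linearZ.
(* The subtracted power makes the induction telescope: each new term adds at most [|a N|] times half
   of it. *)
have close m : `|a N - phi N (series (fun k => a k *: v k) (N.+1 + m)%N)| <=
    `|a N| * (2^-1 - 2^-1 ^+ (N.+1 + m)).
  rewrite phiE; elim: m => [|m IH].
    rewrite addn0 big_nat_recr//= diag mulr1 big_nat big1 ?add0r ?subrr ?normr0.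
      rewrite mulr_ge0// subr_ge0 exprS ler_piMr ?invr_ge0// exprn_ile1 ?invr_ge0//.
      by rewrite invf_le1// ler1n.
    by move=> i iN; rewrite lower ?mulr0.
  rewrite addnS big_nat_recr ?leq0n//= opprD addrA.
  apply: (le_trans (ler_normB _ _)).
  have last : `|a (N.+1 + m)%N * phi N (v (N.+1 + m)%N)| <=
      `|a N| * 2^-1 ^+ (N.+1 + m).+1.
    by rewrite normrM ler_pM// upper// ltn_addr.
  apply: (le_trans (lerD IH last)); rewrite -mulrDr ler_wpM2l// exprS; lra.
have lim0 : (fun n => phi N (series (fun k => a k *: v k) n)) @ \oo --> (0 : R^o).
  rewrite -(linear0 (phi N)).
  by apply: (@cvg_comp _ _ _ _ (phi N : V -> R^o) _ _ _ a0); exact: dual_continuous.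
have /cvgrPdist_lt/(_ (`|a N| * 2^-1)) := lim0.
rewrite mulr_gt0 ?normr_gt0 ?invr_gt0// => /(_ isT)[n _ /(_ (N.+1 + n)%N)] /=.
rewrite leq_addl sub0r normrN => /(_ isT) small.
have := close n.
have := lerB_dist (a N) (phi N (series (fun k => a k *: v k) (N.+1 + n)%N)).
have : 0 < `|a N| * 2^-1 ^+ (N.+1 + n).
  by rewrite mulr_gt0 ?normr_gt0// exprn_gt0// invr_gt0.
lra.
Qed.

End Ell1Operators.

(** * Triangular systems in an operator range *)

Section DenseOperatorRange.
Variables (R : realType) (V : normedModType R) (E : completeNormedModType R).
Variable T : {linear E -> V}.

Lemma ler_sum_mem (I : eqType) (s : seq I) (F : I -> R) (i : I) :
  (forall j, 0 <= F j) -> i \in s -> F i <= \sum_(j <- s) F j.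
Proof. by move=> F0 si; rewrite (big_rem i)//= lerDl sumr_ge0. Qed.

Lemma infinite_dim_notin_span (s : seq E) : infinite_dim E -> injective T ->
  exists z, ~ lin_span [set` map T s] (T z).
Proof.
move=> infE injT; apply: contrapT => /forallNP spanT; apply: infE.
exists (size s), (tnth (in_tuple s)); apply/seteqP; split=> // z _.
have /contrapT[n [c [w [sw Tz]]]] := spanT z.
have /choice[k kw] : forall i, exists j, T (tnth (in_tuple s) j) = w i.
  move=> i; have /mapP[e es ->] := sw i.
  by have /tnthP[j ->] : e \in in_tuple s by []; exists j.
exists n, c, (fun i => tnth (in_tuple s) (k i)); split; first by move=> i; exists (k i).
by apply: injT; rewrite Tz linear_sum; apply: eq_bigr => i _; rewrite linearZ /= kw.
Qed.

(** Only the direction of the new vector has to approximate [T e], so it can be scaled down until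
    its norm and the values of the earlier functionals on it are small; the new functional is
    rescaled accordingly. *)
Lemma triangular_step (s : seq (E * dual V)) (e : E) (eta delta : R) :
    infinite_dim E -> injective T -> 0 < eta -> 0 < delta -> delta <= 1 ->
  exists q : E * dual V, [/\ `|q.1| <= 1,
    (exists2 c : R, 0 < c & `|c *: T q.1 - T e| <= eta), q.2 (T q.1) = 1,
    (forall q', q' \in s -> q.2 (T q'.1) = 0) &
    (forall q', q' \in s -> `|q'.2 (T q.1)| <= delta)].
Proof.
move=> infE injT eta0 delta0 delta1.
have [z zs] := infinite_dim_notin_span (map fst s) infE injT.
have [phi phiz phis] := dual_triangular zs.
have [e1 phie1 ee1] : exists2 e1, phi (T e1) != 0 & `|T e1 - T e| <= eta.
  have [phie|phie] := eqVneq (phi (T e)) 0; last first.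
    by exists e => //; rewrite subrr normr0 ltW.
  have z0 : 0 < 1 + `|T z| by rewrite ltr_pwDl.
  (* A shift towards [z], of size at most [eta] after applying [T], makes [phi] nonzero. *)
  exists (e + (eta / (1 + `|T z|)) *: z).
    rewrite !linearD !linearZ /= phie phiz add0r -[_ *: _]/(_ * _) mulr1.
    by rewrite gt_eqF// divr_gt0.
  rewrite linearD linearZ /= addrC addKr normrZ gtr0_norm ?divr_gt0//.
  by rewrite mulrAC ler_pdivrMr// ler_pM2l// lerDr.
(* [M] dominates [|e1|] and every [|q'.2 (T e1)|], so the single factor [delta / M] meets all the
   bounds. *)
pose M := 1 + (`|e1| + \sum_(q' <- s) `|q'.2 (T e1)|).
have M0 : 0 < M by rewrite ltr_pwDl// addr_ge0// sumr_ge0.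
have c0 : 0 < delta / M by rewrite divr_gt0.
have phiZ t x : phi (t *: x) = t * phi x by rewrite linearZ.
have bound t : t <= M -> delta / M * t <= delta.
  by move=> tM; rewrite mulrAC ler_pdivrMr// ler_pM2l.
have [psi psiE] : exists psi : dual V,
    forall x, psi x = (delta / M * phi (T e1))^-1 * phi x.
  by exists ((delta / M * phi (T e1))^-1 *: phi).
exists ((delta / M) *: e1, psi); split => /=.
- rewrite normrZ gtr0_norm//; apply: le_trans delta1; apply: bound.
  by rewrite /M addrCA lerDl addr_ge0// sumr_ge0.
- exists (delta / M)^-1; first by rewrite invr_gt0.
  by rewrite linearZ scalerA mulVf ?gt_eqF// scale1r.
- by rewrite psiE linearZ phiZ mulVf// mulf_neq0// gt_eqF.
- by move=> q' q's; rewrite psiE (phis (T q'.1)) ?mulr0//; exact: (map_f T (map_f fst q's)).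
- move=> q' q's; rewrite linearZ linearZ /= -[_ *: _]/(_ * _) normrM gtr0_norm//.
  apply: bound; rewrite /M addrA; apply: ler_wpDl; first by rewrite addr_ge0.
  exact: (@ler_sum_mem _ _ (fun q' : E * dual V => `|q'.2 (T e1)|)).
Qed.

Lemma triangular_sequence (e : nat -> E) (eta : nat -> R) :
    infinite_dim E -> injective T -> (forall n, 0 < eta n) ->
  exists (u : nat -> E) (phi : nat -> dual V), [/\ forall n, `|u n| <= 1,
    forall n, exists2 c : R, 0 < c & `|c *: T (u n) - T (e n)| <= eta n,
    forall n, phi n (T (u n)) = 1,
    forall j n, (j < n)%N -> phi n (T (u j)) = 0 &
    forall j n, (j < n)%N -> `|phi j (T (u n))| <= 2^-1 ^+ n.+1].
Proof.
move=> infE injT eta0.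
have half_gt0 n : 0 < (2^-1 : R) ^+ n by rewrite exprn_gt0// invr_gt0.
have half_le1 n : (2^-1 : R) ^+ n <= 1.
  by rewrite exprn_ile1 ?invr_ge0// invf_le1// ler1n.
have /choice[F FP] := fun sn : seq (E * dual V) * nat =>
  @triangular_step sn.1 (e sn.2) (eta sn.2) (2^-1 ^+ sn.2.+1) infE injT (eta0 _)
    (half_gt0 _) (half_le1 _).
(* [hist n] lists the first [n] pairs, newest first; the next pair is chosen from this list and the
   stage [n]. *)
pose hist := fix hist n := if n is m.+1 then F (hist m, m) :: hist m else [::].
pose q n := F (hist n, n).
have qhist j n : (j < n)%N -> q j \in hist n.
  elim: n => // n IH; rewrite ltnS leq_eqVlt inE => /predU1P[->|/IH ->].
    by rewrite eqxx.
  by rewrite orbT.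
exists (fun n => (q n).1), (fun n => (q n).2); split=> [n|n|n|j n jn|j n jn];
  case: (FP (hist n, n)) => //= _ _ _ h1 h2.
  by apply: h1; exact: qhist.
by apply: h2; exact: qhist.
Qed.

(** The series is summed in [E], which is complete, and then mapped by [T]; this keeps the range
    inside that of [T]. Injectivity comes from that of [T] and [triangular_series_eq0]. *)
Lemma triangular_operator (e : nat -> E) (eta : nat -> R) :
    infinite_dim E -> injective T -> bounded_fun_norm T -> (forall n, 0 < eta n) ->
  exists S : {linear ell1 R -> V}, [/\ bounded_fun_norm S, injective S,
    range S `<=` range T & forall n, exists2 c : R, 0 < c &
      `|c *: S (ell1_delta R n) - T (e n)| <= eta n].
Proof.
move=> infE injT bT eta0.
have [u [phi [u1 approx diag lower upper]]] := triangular_sequence e infE injT eta0.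
have [S0 [S0b S0cvg]] := ell1_synthesis u1.
have cT : continuous T by exact/bounded_linear_continuous/bounded_funP.
have S0delta n : S0 (ell1_delta R n) = u n.
  rewrite -(cvg_lim (@norm_hausdorff _ _) (S0cvg (ell1_delta R n))).
  by apply: cvg_lim => //; exact: series_ell1_delta.
exists (T \o S0); split.
- move=> r; have [M TM] := bT r; exists M => a ar; apply: TM.
  exact: le_trans (S0b a) ar.
- move=> a b /injT/eqP; rewrite -subr_eq0 -linearB => /eqP S0ab.
  apply/eqP; rewrite -subr_eq0; apply/eqP.
  apply: (triangular_series_eq0 diag lower upper).
  have -> : series (fun k => (a - b) k *: T (u k)) =
      T \o series (fun k => (a - b) k *: u k).
    by apply/funext => n; rewrite /series/= linear_sum;
      apply: eq_bigr => k _; rewrite linearZ.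
  rewrite -(linear0 T) -S0ab; apply: cvg_comp (S0cvg _) _; exact: cT.
- by move=> _ [a _ <-]; exists (S0 a).
- by move=> n; rewrite /= S0delta.
Qed.

End DenseOperatorRange.

(** * Modesty and the Read construction *)

Section ReadConstruction.
Variables (R : realType) (V : normedModType R).

Lemma opnorm_normalize (E : normedModType R) (S : {linear E -> V}) :
    bounded_fun_norm S -> injective S -> (exists x : E, x != 0) ->
  exists2 k : R, 0 < k & opnorm (k \*: S : E -> V) = 1.
Proof.
move=> bS injS [x x0].
have cS : continuous S by exact/bounded_linear_continuous/bounded_funP.
have S0 : 0 < opnorm S.
  rewrite lt_neqAle opnorm_ge0 andbT eq_sym; apply/eqP => S0.
  have := opnorm_bound x cS; rewrite S0 mul0r normr_le0 => /eqP Sx.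
  by move/eqP: x0; apply; apply: injS; rewrite Sx linear0.
have k0 : 0 < (opnorm S)^-1 by rewrite invr_gt0.
exists (opnorm S)^-1 => //; apply/eqP; rewrite eq_le; apply/andP; split.
  apply: opnorm_le => y y1 /=; rewrite normrZ gtr0_norm// ler_pdivrMl// mulr1.
  by apply: (le_trans (opnorm_bound y cS)); rewrite ler_piMr ?opnorm_ge0.
rewrite -(ler_pM2l S0) mulr1; apply: opnorm_le => y y1.
have ckS : continuous ((opnorm S)^-1 \*: S).
  apply: (@linear_bound_continuous _ _ _ ((opnorm S)^-1 \*: S) 1) => z.
  by rewrite /= normrZ gtr0_norm// mul1r ler_pdivrMl//; exact: opnorm_bound.
have := opnorm_bound (f := (opnorm S)^-1 \*: S) y ckS.
rewrite /= normrZ gtr0_norm// ler_pdivrMl// => /le_trans; apply.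
by rewrite ler_pM2l// ler_piMr ?opnorm_ge0.
Qed.

Lemma countable_range_enum (E : lmodType R) (T : {linear E -> V}) (A : set V) :
    countable A -> A `<=` range T ->
  exists e : nat -> E, forall y, A y -> exists n, T (e n) = y.
Proof.
move=> /countable_injP[c cinj] AT.
have /choice[e eP] : forall n, exists e : E, forall y, A y -> c y = n -> T e = y.
  move=> n; have [[y [Ay cy]]|noy] := pselect (exists y, A y /\ c y = n); last first.
    by exists 0 => y Ay cy; case: noy; exists y.
  have [e _ Te] := AT y Ay; exists e => z Az cz.
  by rewrite Te; apply: cinj; rewrite ?inE// cy.
by exists e => y Ay; exists (c y); exact: eP.
Qed.

Lemma dense_operator (E : completeNormedModType R) (T : {linear E -> V}) :
    infinite_dim E -> injective T -> bounded_fun_norm T ->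
    separable_set (range T) -> dense (range T) ->
  exists S : {linear ell1 R -> V}, [/\ bounded_fun_norm S, injective S,
    opnorm S = 1, range S `<=` range T &
    exists2 c : nat -> R, forall n, 0 < c n &
      dense (range (fun n => c n *: S (ell1_delta R n)))].
Proof.
move=> infE injT bT [A [cA AT TA]] dT.
have [e eA] := countable_range_enum cA AT.
(* Stage [n] codes a pair [(m, j)], asking for the target [e m] within [1 / (j + 1)]; each target
   thus recurs with arbitrarily small error. Numbers coding no pair default to [(0, 0)]. *)
pose idx n : nat * nat := odflt (0, 0)%N (unpickle n).
have [|S [bS injS ST approx]] := @triangular_operator _ _ _ T (fun n => e (idx n).1)
  (fun n => (idx n).2.+1%:R^-1) infE injT bT.
  by move=> n; rewrite invr_gt0.
have /choice[c cP] : forall n, exists c, 0 < c /\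
    `|c *: S (ell1_delta R n) - T (e (idx n).1)| <= (idx n).2.+1%:R^-1.
  by move=> n; have [c c0 cn] := approx n; exists c.
have [|k k0 kS] := opnorm_normalize bS injS.
  by exists (ell1_delta R 0); rewrite -normr_eq0 ell1_norm_delta oner_neq0.
exists (k \*: S); split => //.
- by move=> r; have [M SM] := bS r; exists (`|k| * M) => a ar;
    rewrite /= normrZ ler_wpM2l// SM.
- by move=> a b /=/(scalerI (lt0r_neq0 k0))/injS.
- by move=> _ [a _ <-]; apply: ST; exists (k *: a); rewrite ?linearZ.
(* Dividing by [k] undoes the normalisation of [S]. *)
exists (fun n => c n / k) => [n|]; first by rewrite divr_gt0// (cP n).1.
move=> O [x Ox] oO.
have [y [Oy Ty]] := dT O (ex_intro _ x Ox) oO.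
have /TA/(_ O) := Ty; have : nbhs y O by exact: open_nbhs_nbhs.
move=> /[swap]/[apply] -[z [Az Oz]].
have [m Tm] := eA z Az.
have /nbhs_ballP[d /= d0 dO] : nbhs z O by exact: open_nbhs_nbhs.
have [j jd] : exists j, j.+1%:R^-1 < d.
  have /cvgrPdist_lt/(_ _ d0)[j _ /(_ j (leqnn j))] := @cvg_harmonic R.
  by rewrite /= sub0r normrN ger0_norm ?invr_ge0// => ?; exists j.
have idxE : idx (pickle (m, j)) = (m, j) by rewrite /idx pickleK.
exists ((c (pickle (m, j)) / k) *: (k *: S (ell1_delta R (pickle (m, j)))));
  split; last first.
  by exists (pickle (m, j)).
rewrite scalerA divfK ?gt_eqF//; apply: dO; rewrite -ball_normE /= -normrN opprB.
by apply: le_lt_trans jd; have := (cP (pickle (m, j))).2; rewrite idxE /= Tm.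
Qed.

(** The map [z / |z|] is continuous at [y], fixes [y], and forgets the positive factors [c n]. *)
Lemma dense_normalized (v : nat -> V) (c : nat -> R) :
    (forall n, 0 < c n) -> dense (range (fun n => c n *: v n)) ->
  [set y | `|y| = 1] `<=` closure (range (fun n => `|v n|^-1 *: v n)).
Proof.
move=> c0 dv y /= y1 O Oy.
have cn : (fun z : V => `|z|^-1 *: z) @ y --> `|y|^-1 *: y.
  apply: cvgZ; last exact: cvg_id.
  by apply: cvgV; [rewrite y1 oner_neq0|apply: cvg_norm; exact: cvg_id].
have /cn : nbhs (`|y|^-1 *: y) O by rewrite y1 invr1 scale1r.
rewrite -[_ O]/(nbhs y ((fun z : V => `|z|^-1 *: z) @^-1` O)) nbhsE => -[U [oU Uy] UO].
have [z [Uz [n _ vz]]] := dv U (ex_intro _ y Uy) oU.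
exists (`|v n|^-1 *: v n); split; first by exists n.
have := UO _ Uz; rewrite -vz /= normrZ gtr0_norm// scalerA invfM mulrAC mulVf ?mul1r//.
by rewrite gt_eqF.
Qed.

End ReadConstruction.

(** Evaluations are norm continuous, so weak-star open sets are norm open. *)
Lemma weak_star_dense (R : realType) (X : normedModType R) (Y : set (dual X)) :
  dense Y -> dense (Y : set (weak_star X)).
Proof.
move=> dY O O0 [U oU UO]; apply: dY => //; rewrite -UO.
apply: (@open_comp _ {ptws X -> R^o} (fun f : dual X => f : {ptws X -> R^o})) => // f _.
have FF : Filter ((fun g : dual X => g : X -> R^o) @ f).
  by exact: fmap_filter (nbhs_filter f).
apply: (iffRL (@pointwise_cvgP X R^o _ (f : X -> R^o) FF)) => x.
have [Phi PhiE] := dual_evaluation x.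
have -> : (f : X -> R^o) x = Phi f by rewrite PhiE.
have := @dual_continuous _ _ Phi f; rewrite /continuous_at.
have -> // : (Phi : dual X -> R^o) = (fun g : dual X => g x).
  by apply/funext => g; exact: PhiE.
Qed.

Lemma modest_read_construction (R : realType) (X : normedModType R) :
    modest (lin_span (norm_attaining X)) ->
  exists D : read_construction X, dense (range (rc_T D)).
Proof.
move=> [_ [[E [T [infE bT injT <-]]] sT dT ZT]].
have [S [bS injS S1 ST [c c0 dS]]] := dense_operator infE injT bT sT dT.
have drS : dense (range S).
  move=> O O0 oO; have [x [Ox [n _ xE]]] := dS O O0 oO.
  by exists x; split=> //; exists (c n *: ell1_delta R n); rewrite // linearZ.
have oS : operator_range (range S).
  by exists (ell1 R), S; split=> //; exact: ell1_infinite_dim.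
have sS : separable_set (range S).
  exists (range (fun n => c n *: S (ell1_delta R n))); split.
  - exact: card_image_le.
  - by move=> _ [n _ <-]; exists (c n *: ell1_delta R n); rewrite // linearZ.
  - move=> x _ O /=; rewrite nbhsE => -[U [oU Ux] UO].
    have [y [Uy yS]] := dS U (ex_intro _ x Ux) oU.
    by exists y; split=> //; exact: UO.
(* The range of [S] lies in the given operator range and so inherits its trivial intersection with
   the span. *)
have disj : range S `&` lin_span (norm_attaining X) = [set 0].
  apply/seteqP; split=> [x [Sx Zx]|_ ->].
    by rewrite -ZT; split=> //; exact: ST.
  split; first by exists 0; rewrite // linear0.
  by have : [set (0 : dual X)] 0 by []; rewrite -ZT => -[].
have sph : [set y | range S y /\ `|y| = 1] `<=`
    closure (range (fun n => `|S (ell1_delta R n)|^-1 *: S (ell1_delta R n))).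
  by move=> y [_ y1]; exact: (dense_normalized c0 dS).
have half : (0 : R) < 2^-1 by rewrite invr_gt0.
(* The weights are [r_n = 2^-n]. *)
have geo : cvgn (series (geometric (1 : R) 2^-1)).
  by apply: is_cvg_geometric_series; rewrite gtr0_norm// invf_lt1// ltr1n.
have geo0 n : 0 < geometric (1 : R) 2^-1 n by rewrite /= mul1r exprn_gt0.
by exists (ReadConstruction bS S1 injS oS sS (weak_star_dense drS) disj sph geo0 geo).
Qed.

Theorem proposition3p4 (R : realType) (X : completeNormedModType R) :
  (weak_star_modest (lin_span (norm_attaining X)) ->
     forall D : read_construction X, strictly_convex (renorm (read_norm D))) /\
  (modest (lin_span (norm_attaining X)) ->
     exists D : read_construction X,
       strictly_convex (dual (dual (renorm (read_norm D)))) /\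
       smooth (dual (renorm (read_norm D)))).
Proof.
split=> [_ D|]; first exact: read_norm_strictly_convex.
move=> /modest_read_construction[D dD]; exists D.
have sc := read_bidual_strictly_convex dD.
by split=> //; exact: smooth_of_strictly_convex_dual.
Qed.
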